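(* Let $G=\langle x_1,\dots,x_n\mid r\rangle$ be a $1$-relator group, and let $F$ be the free group on $\mathbf{x}=\{x_1,\dots,x_n\}$. Then, up to isomorphism of graded Lie algebras: \begin{enumerate} \item If $r\in[F,F]$, then $\mathfrak{h}(G)\cong\mathfrak{lie}(\mathbf{x})/\mathrm{ideal}(M_2(r))$. \item If $r\notin[F,F]$, then $\mathfrak{h}(G)\cong\mathfrak{lie}(y_1,\dots,y_{n-1})$, the free Lie algebra on $n-1$ generators of degree $1$. \end{enumerate}
   Context: $\mathfrak{lie}(\cdot)$ denotes the free Lie algebra over $\mathbb{Q}$ with generators in degree $1$. The Magnus expansion $M\colon\mathbb{Z}F\to\mathbb{Z}\langle\langle x_1,\dots,x_n\rangle\rangle$ (power series in non-commuting variables) is the ring morphism with $M(x_i)=1+x_i$; let $\varepsilon_{i,j}(r)$ be the coefficient of $x_ix_j$ in $M(r)$. For $r\in[F,F]$ the degree $2$ part of $M(r)$ is $M_2(r)=\sum_{i<j}\varepsilon_{i,j}(r)(x_ix_j-x_jx_i)$, identified with $\sum_{i<j}\varepsilon_{i,j}(r)[x_i,x_j]\in\mathfrak{lie}_2(\mathbf{x})$. For a finitely generated group $G$, the holonomy Lie algebra is $\mathfrak{h}(G)=\mathfrak{lie}(H_1(G;\mathbb{Q}))/\langle\operatorname{im}\mu_G^\vee\rangle$, where $\mu_G^\vee\colon H_2(G;\mathbb{Q})\to\bigwedge^2H_1(G;\mathbb{Q})\cong\mathfrak{lie}_2(H_1(G;\mathbb{Q}))$ (with $v\wedge w\leftrightarrow[v,w]$)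 is the dual of the cup-product map $\mu_G\colon H^1(G;\mathbb{Q})\wedge H^1(G;\mathbb{Q})\to H^2(G;\mathbb{Q})$. *)

(* Defs.v *)
From HB Require Import structures.
From mathcomp Require Import all_boot all_algebra generic_quotient.
From mathcomp Require Import boolp classical_sets functions.
From mathcomp Require Import ring.
From mathcomp.multinomials Require Import freeg.

Set Implicit Arguments.
Unset Strict Implicit.
Unset Printing Implicit Defensive.

Import GRing.Theory.

Local Open Scope ring_scope.
Local Open Scope quotient_scope.

Section QuotientModule.
Variables (R : pzRingType) (V : lmodType R) (U : submodClosed V).

Lemma submod_rpredN (x : V) : x \in U -> - x \in U.
Proof. by move=> Ux; rewrite -scaleN1r rpredZ. Qed.

Definition lquot_equiv (x y : V) : bool := x - y \in U.

Lemma lquot_equiv_class : equiv_class_of lquot_equiv.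
Proof.
split=> [x|x y|y x z]; rewrite /lquot_equiv ?subrr ?rpred0 //.
  by apply/idP/idP=> /submod_rpredN; rewrite opprB.
by move=> xy yz; rewrite -[x](addrNK y) -addrA rpredD.
Qed.
Canonical lquot_equiv_rel := EquivRelPack lquot_equiv_class.
Canonical lquot_encModRel := defaultEncModRel lquot_equiv.

Definition lquot := {eq_quot lquot_equiv}.
HB.instance Definition _ := EqQuotient.on lquot.
HB.instance Definition _ := Choice.on lquot.

Definition lquot_pi (x : V) : lquot := \pi_lquot x.

Lemma lquot_eqP (x y : V) : lquot_pi x = lquot_pi y <-> x - y \in U.
Proof.
rewrite /lquot_pi; split=> [/eqP|xy]; first by rewrite piE.
by apply/eqP; rewrite piE.
Qed.

Lemma lquot_reprK (x : lquot) : lquot_pi (repr x) = x.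
Proof. exact: reprK. Qed.

Lemma lquot_repr_pi (x : V) : repr (lquot_pi x) - x \in U.
Proof. by apply/lquot_eqP; rewrite lquot_reprK. Qed.

Lemma lquotW (P : lquot -> Prop) : (forall x, P (lquot_pi x)) -> forall x, P x.
Proof. by move=> PU x; rewrite -[x]lquot_reprK. Qed.

Definition lquot_add (x y : lquot) := lquot_pi (repr x + repr y).
Definition lquot_opp (x : lquot) := lquot_pi (- repr x).
Definition lquot_scale (a : R) (x : lquot) := lquot_pi (a *: repr x).

Lemma lquot_piD x y : lquot_add (lquot_pi x) (lquot_pi y) = lquot_pi (x + y).
Proof.
by apply/lquot_eqP; rewrite opprD addrACA rpredD ?lquot_repr_pi.
Qed.

Lemma lquot_piN x : lquot_opp (lquot_pi x) = lquot_pi (- x).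
Proof. by apply/lquot_eqP; rewrite -opprD submod_rpredN ?lquot_repr_pi. Qed.

Lemma lquot_piZ a x : lquot_scale a (lquot_pi x) = lquot_pi (a *: x).
Proof. by apply/lquot_eqP; rewrite -scalerBr rpredZ ?lquot_repr_pi. Qed.

Lemma lquot_addA : associative lquot_add.
Proof.
by elim/lquotW=> x; elim/lquotW=> y; elim/lquotW=> z; rewrite !lquot_piD addrA.
Qed.
Lemma lquot_addC : commutative lquot_add.
Proof. by elim/lquotW=> x; elim/lquotW=> y; rewrite !lquot_piD addrC. Qed.
Lemma lquot_add0 : left_id (lquot_pi 0) lquot_add.
Proof. by elim/lquotW=> x; rewrite lquot_piD add0r. Qed.
Lemma lquot_addN : left_inverse (lquot_pi 0) lquot_opp lquot_add.
Proof. by elim/lquotW=> x; rewrite lquot_piN lquot_piD addNr. Qed.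
HB.instance Definition _ :=
  GRing.isZmodule.Build lquot lquot_addA lquot_addC lquot_add0 lquot_addN.

Lemma lquot_scaleA a b x :
  lquot_scale a (lquot_scale b x) = lquot_scale (a * b) x.
Proof. by elim/lquotW: x => x; rewrite !lquot_piZ scalerA. Qed.
Lemma lquot_scale1 : left_id 1 lquot_scale.
Proof. by elim/lquotW=> x; rewrite lquot_piZ scale1r. Qed.
Lemma lquot_scaleDr : right_distributive lquot_scale +%R.
Proof.
move=> a; elim/lquotW=> x; elim/lquotW=> y.
by rewrite [x in lquot_scale a x]lquot_piD !lquot_piZ [RHS]lquot_piD scalerDr.
Qed.
Lemma lquot_scaleDl x : {morph lquot_scale^~ x : a b / a + b}.
Proof.
by move=> a b; elim/lquotW: x => x; rewrite !lquot_piZ [RHS]lquot_piD scalerDl.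
Qed.
HB.instance Definition _ := GRing.Zmodule_isLmodule.Build R lquot
  lquot_scaleA lquot_scale1 lquot_scaleDr lquot_scaleDl.

Lemma lquot_pi_linear : linear lquot_pi.
Proof. by move=> a x y; rewrite -lquot_piD -lquot_piZ. Qed.
HB.instance Definition _ :=
  GRing.isLinear.Build R V lquot *:%R lquot_pi lquot_pi_linear.

(* The map induced on V / U by f; meaningful when f is constant on the classes
   modulo U, see lquot_liftE. *)
Definition lquot_lift (W : Type) (f : V -> W) (x : lquot) : W := f (repr x).

Lemma lquot_liftE (W : zmodType) (f : V -> W) :
  zmod_morphism f -> (forall x, x \in U -> f x = 0) ->
  forall x, lquot_lift f (lquot_pi x) = f x.
Proof.
move=> fB fU x; apply/eqP; rewrite -subr_eq0 -fB.
by rewrite fU ?lquot_repr_pi.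
Qed.

End QuotientModule.

Section Subspaces.
Variables (R : pzRingType) (V : lmodType R).

Definition lspan (S : V -> Prop) : {pred V} := fun x =>
  `[< forall U : submodClosed V, (forall y, S y -> y \in U) -> x \in U >].

Lemma lspanP S x : reflect
  (forall U : submodClosed V, (forall y, S y -> y \in U) -> x \in U)
  (x \in lspan S).
Proof. exact: asboolP. Qed.

Lemma lspan_subsemimod S : subsemimod_closed (lspan S).
Proof.
split; [split|].
- by apply/lspanP=> U _; rewrite rpred0.
- move=> x y /lspanP Sx /lspanP Sy; apply/lspanP=> U SU.
  by rewrite rpredD ?Sx ?Sy.
- by move=> a x /lspanP Sx; apply/lspanP=> U SU; rewrite rpredZ ?Sx.
Qed.
HB.instance Definition _ S :=
  GRing.isSubSemiModClosed.Build R V (lspan S) (lspan_subsemimod S).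

Lemma lspan_gen (S : V -> Prop) x : S x -> x \in lspan S.
Proof. by move=> Sx; apply/lspanP=> U; apply. Qed.

Lemma lspan_ker (W : lmodType R) (f : {linear V -> W}) (S : V -> Prop) :
  (forall y, S y -> f y = 0) -> forall x, x \in lspan S -> f x = 0.
Proof.
move=> fS x.
pose K : {pred V} := fun x => f x == 0.
have KE y : (y \in K) = (f y == 0) by [].
have Kclosed : subsemimod_closed K.
  split; [split|].
  - by rewrite KE raddf0.
  - by move=> u v; rewrite !KE => /eqP fu /eqP fv; rewrite linearD /= fu fv addr0.
  - by move=> a u; rewrite !KE linearZ => /eqP-> /=; rewrite scaler0.
pose KC := GRing.isSubSemiModClosed.Build R V K Kclosed.
pose KU : submodClosed V := HB.pack K KC.
by move/lspanP=> /(_ KU) Kx; apply/eqP; apply: Kx => y /fS fy; rewrite KE fy.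
Qed.

End Subspaces.


Section FreeModule.
Variables (R : nzRingType) (K : choiceType) (W : lmodType R).

Lemma fglift_zmod_morphism (f : K -> W) :
  zmod_morphism (fglift f : {freeg K / R} -> W).
Proof. exact: lift_is_additive. Qed.
HB.instance Definition _ f := GRing.isZmodMorphism.Build {freeg K / R} W
  (fglift f) (fglift_zmod_morphism f).

Lemma fglift_scalable (f : K -> W) : scalable (fglift f : {freeg K / R} -> W).
Proof.
move=> a x; rewrite -[x]freeg_sumE.
elim: (dom x) => [|k s IHs]; first by rewrite !big_nil scaler0 raddf0 scaler0.
rewrite big_cons scalerDr !raddfD /= IHs; congr (_ + _).
have -> : a *: << coeff k x *g k >> = << a * coeff k x *g k >> :> {freeg K / R}.
  by apply/eqP/freeg_eqP=> j; rewrite coeffZ !coeffU mulrA.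
by rewrite !liftU scalerA.
Qed.
HB.instance Definition _ f :=
  GRing.isScalable.Build R {freeg K / R} W *:%R (fglift f) (fglift_scalable f).

End FreeModule.

Lemma linear_fun0 (R : pzRingType) (V W : lmodType R) (f : V -> W) :
  linear f -> f 0 = 0.
Proof.
move=> f_lin; have /eqP := f_lin 1 0 0.
by rewrite !scale1r addr0 -subr_eq subrr eq_sym => /eqP.
Qed.

Section ExteriorSquare.
Variables (R : comNzRingType) (V : lmodType R).

Inductive wedge_rel : {freeg (V * V)%type / R} -> Prop :=
  | WedgeLinl a u v w :
      wedge_rel (<< (a *: u + v, w) >> - (a *: << (u, w) >> + << (v, w) >>))
  | WedgeLinr a u v w :
      wedge_rel (<< (w, a *: u + v) >> - (a *: << (w, u) >> + << (w, v) >>))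
  | WedgeAlt v : wedge_rel << (v, v) >>.

Definition ext2 := lquot (lspan wedge_rel).
HB.instance Definition _ := GRing.Lmodule.on ext2.

Definition wedge (u v : V) : ext2 := lquot_pi (lspan wedge_rel) << (u, v) >>.

Definition alternating (W : lmodType R) (f : V -> V -> W) : Prop :=
  [/\ forall w, linear (f^~ w), forall w, linear (f w) & forall v, f v v = 0].

Lemma alternatingC (W : lmodType R) (f : V -> V -> W) u v :
  alternating f -> f u v = - f v u.
Proof.
case=> fl fr fvv; apply/eqP; rewrite -addr_eq0; apply/eqP.
have lD x y z : f (x + y) z = f x z + f y z.
  by have := fl z 1 x y; rewrite /= !scale1r.
have rD x y z : f z (x + y) = f z x + f z y.
  by have := fr z 1 x y; rewrite !scale1r.
by have := fvv (u + v); rewrite lD !rD !fvv add0r addr0.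
Qed.

(* The linear map sending wedge u v to f u v; meaningful when f is alternating,
   see ext2_lift_wedge. *)
Definition ext2_lift (W : lmodType R) (f : V -> V -> W) : ext2 -> W :=
  lquot_lift (fglift (fun p : V * V => f p.1 p.2)).

Section Lift.
Variables (W : lmodType R) (f : V -> V -> W) (f_alt : alternating f).

Lemma ext2_lift_pi x :
  ext2_lift f (lquot_pi _ x) = fglift (fun p : V * V => f p.1 p.2) x.
Proof.
case: f_alt => fl fr fvv.
apply: lquot_liftE; first exact: fglift_zmod_morphism.
apply: (@lspan_ker _ _ W (fglift (fun p : V * V => f p.1 p.2))) => y.
case=> [a u v w|a u v w|v].
- rewrite raddfB /= linearP /= !liftU !scale1r /=.
  by have /= -> := fl w a u v; rewrite subrr.
- rewrite raddfB /= linearP /= !liftU !scale1r /=.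
  by rewrite fr subrr.
- by rewrite /= liftU scale1r /= fvv.
Qed.

Lemma ext2_lift_wedge u v : ext2_lift f (wedge u v) = f u v.
Proof. by rewrite ext2_lift_pi liftU scale1r. Qed.

Lemma ext2_lift_linear : linear (ext2_lift f).
Proof.
move=> a; elim/lquotW=> x; elim/lquotW=> y.
by rewrite -linearP !ext2_lift_pi linearP.
Qed.

End Lift.

Lemma wedge_alternating : alternating wedge.
Proof.
split=> [w a u v|w a u v|v]; rewrite /wedge.
- rewrite -linearP; apply/lquot_eqP; apply: lspan_gen; exact: WedgeLinl.
- rewrite -linearP; apply/lquot_eqP; apply: lspan_gen; exact: WedgeLinr.
- rewrite -(raddf0 (lquot_pi _)); apply/lquot_eqP; rewrite subr0.
  apply: lspan_gen; exact: WedgeAlt.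
Qed.

Lemma ext2_ind (P : ext2 -> Prop) : P 0 ->
  (forall a u v x, P x -> P (a *: wedge u v + x)) -> forall x, P x.
Proof.
move=> P0 PS; elim/lquotW=> x; rewrite -[x]freeg_sumE.
elim: (dom x) => [|[u v] s IHs]; first by rewrite big_nil raddf0.
rewrite big_cons.
have -> : << coeff (u, v) x *g (u, v) >> = coeff (u, v) x *: << (u, v) >>
    :> {freeg (V * V)%type / R}.
  by apply/eqP/freeg_eqP=> j; rewrite coeffZ !coeffU mul1r.
rewrite linearP; exact: PS.
Qed.

End ExteriorSquare.

HB.mixin Record Lmodule_isLieAlgebra (R : pzRingType) L of GRing.Lmodule R L := {
  bracket : L -> L -> L;
  bracket_linearl : forall y, linear (bracket^~ y);
  bracket_linearr : forall x, linear (bracket x);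
  bracketxx : forall x, bracket x x = 0;
  jacobi : forall x y z,
    bracket x (bracket y z) + bracket y (bracket z x)
      + bracket z (bracket x y) = 0
}.
#[short(type="lieAlgType")]
HB.structure Definition LieAlgebra (R : pzRingType) :=
  {L of Lmodule_isLieAlgebra R L & GRing.Lmodule R L}.

Lemma bracket_alternating (R : comNzRingType) (L : lieAlgType R) :
  alternating (bracket : L -> L -> L).
Proof.
split; [exact: bracket_linearl|exact: bracket_linearr|exact: bracketxx].
Qed.

(* Lie algebras given by generators X and relations rel: Lie expressions in the
   elements of X modulo the least congruence containing rel and the axioms of
   Lie algebras. *)
Section PresentedLieAlgebra.
Variables (R : comNzRingType) (X : Type).

Inductive lie_expr : Type :=
  | LieGen of X
  | LieZero
  | LieOpp of lie_expr
  | LieAdd of lie_expr & lie_expr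
  | LieScale of R & lie_expr
  | LieBracket of lie_expr & lie_expr.
HB.instance Definition _ := gen_eqMixin lie_expr.
HB.instance Definition _ := gen_choiceMixin lie_expr.

Variable rel : lie_expr -> lie_expr -> Prop.

Inductive lie_cong : lie_expr -> lie_expr -> Prop :=
  | LieRel x y : rel x y -> lie_cong x y
  | LieRefl x : lie_cong x x
  | LieSym x y : lie_cong x y -> lie_cong y x
  | LieTrans x y z : lie_cong x y -> lie_cong y z -> lie_cong x z
  | LieOppC x x' : lie_cong x x' -> lie_cong (LieOpp x) (LieOpp x')
  | LieAddC x x' y y' : lie_cong x x' -> lie_cong y y' ->
      lie_cong (LieAdd x y) (LieAdd x' y')
  | LieScaleC a x x' : lie_cong x x' -> lie_cong (LieScale a x) (LieScale a x')
  | LieBracketC x x' y y' : lie_cong x x' -> lie_cong y y' ->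
      lie_cong (LieBracket x y) (LieBracket x' y')
  | LieAddA x y z : lie_cong (LieAdd x (LieAdd y z)) (LieAdd (LieAdd x y) z)
  | LieAddComm x y : lie_cong (LieAdd x y) (LieAdd y x)
  | LieAdd0 x : lie_cong (LieAdd LieZero x) x
  | LieAddN x : lie_cong (LieAdd (LieOpp x) x) LieZero
  | LieScaleA a b x : lie_cong (LieScale a (LieScale b x)) (LieScale (a * b) x)
  | LieScale1 x : lie_cong (LieScale 1 x) x
  | LieScaleDr a x y :
      lie_cong (LieScale a (LieAdd x y)) (LieAdd (LieScale a x) (LieScale a y))
  | LieScaleDl x a b :
      lie_cong (LieScale (a + b) x) (LieAdd (LieScale a x) (LieScale b x))
  | LieBracketl z a x y :
      lie_cong (LieBracket (LieAdd (LieScale a x) y) z)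
        (LieAdd (LieScale a (LieBracket x z)) (LieBracket y z))
  | LieBracketr z a x y :
      lie_cong (LieBracket z (LieAdd (LieScale a x) y))
        (LieAdd (LieScale a (LieBracket z x)) (LieBracket z y))
  | LieBracketxx x : lie_cong (LieBracket x x) LieZero
  | LieJacobi x y z :
      lie_cong
        (LieAdd (LieAdd (LieBracket x (LieBracket y z))
                        (LieBracket y (LieBracket z x)))
                (LieBracket z (LieBracket x y)))
        LieZero.

Definition lie_congb (x y : lie_expr) : bool := `[< lie_cong x y >].

Lemma lie_congb_class : equiv_class_of lie_congb.
Proof.
split=> [x|x y|y x z].
- by apply/asboolP; apply: LieRefl.
- by apply/asboolP/asboolP; apply: LieSym.
- by move=> /asboolP xy /asboolP yz; apply/asboolP; apply: LieTrans xy yz.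
Qed.
Canonical lie_congb_rel := EquivRelPack lie_congb_class.
Canonical lie_congb_encModRel := defaultEncModRel lie_congb.

Definition lie_pres := {eq_quot lie_congb}.
HB.instance Definition _ := EqQuotient.on lie_pres.
HB.instance Definition _ := Choice.on lie_pres.

Definition lie_class (x : lie_expr) : lie_pres := \pi_lie_pres x.

Lemma lie_class_eqP x y : lie_class x = lie_class y <-> lie_cong x y.
Proof.
rewrite /lie_class; split=> [/eqP|xy].
  by rewrite piE => /asboolP.
by apply/eqP; rewrite piE; apply/asboolP.
Qed.

Lemma lie_class_reprK x : lie_class (repr x) = x.
Proof. exact: reprK. Qed.

Lemma lie_repr_class x : lie_cong (repr (lie_class x)) x.
Proof. by apply/lie_class_eqP; rewrite lie_class_reprK. Qed.

Lemma lie_presW (P : lie_pres -> Prop) :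
  (forall x, P (lie_class x)) -> forall x, P x.
Proof. by move=> PU x; rewrite -[x]lie_class_reprK. Qed.

Definition lie_opp (x : lie_pres) := lie_class (LieOpp (repr x)).
Definition lie_add (x y : lie_pres) := lie_class (LieAdd (repr x) (repr y)).
Definition lie_scale a (x : lie_pres) := lie_class (LieScale a (repr x)).
Definition lie_bracket (x y : lie_pres) := lie_class (LieBracket (repr x) (repr y)).

Lemma lie_oppE x : lie_opp (lie_class x) = lie_class (LieOpp x).
Proof. by apply/lie_class_eqP; apply: LieOppC; apply: lie_repr_class. Qed.
Lemma lie_addE x y :
  lie_add (lie_class x) (lie_class y) = lie_class (LieAdd x y).
Proof. by apply/lie_class_eqP; apply: LieAddC; apply: lie_repr_class. Qed.
Lemma lie_scaleE a x : lie_scale a (lie_class x) = lie_class (LieScale a x).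
Proof. by apply/lie_class_eqP; apply: LieScaleC; apply: lie_repr_class. Qed.
Lemma lie_bracketE x y :
  lie_bracket (lie_class x) (lie_class y) = lie_class (LieBracket x y).
Proof. by apply/lie_class_eqP; apply: LieBracketC; apply: lie_repr_class. Qed.

Let lie_classE := (lie_oppE, lie_addE, lie_scaleE, lie_bracketE).

Lemma lie_addA : associative lie_add.
Proof.
elim/lie_presW=> x; elim/lie_presW=> y; elim/lie_presW=> z.
rewrite !lie_classE; apply/lie_class_eqP; exact: LieAddA.
Qed.
Lemma lie_addC : commutative lie_add.
Proof.
elim/lie_presW=> x; elim/lie_presW=> y.
rewrite !lie_classE; apply/lie_class_eqP; exact: LieAddComm.
Qed.
Lemma lie_add0 : left_id (lie_class LieZero) lie_add.
Proof.
elim/lie_presW=> x; rewrite !lie_classE; apply/lie_class_eqP; exact: LieAdd0.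
Qed.
Lemma lie_addN : left_inverse (lie_class LieZero) lie_opp lie_add.
Proof.
elim/lie_presW=> x; rewrite !lie_classE; apply/lie_class_eqP; exact: LieAddN.
Qed.
HB.instance Definition _ :=
  GRing.isZmodule.Build lie_pres lie_addA lie_addC lie_add0 lie_addN.

Lemma lie_scaleA a b x : lie_scale a (lie_scale b x) = lie_scale (a * b) x.
Proof.
elim/lie_presW: x => x; rewrite !lie_classE; apply/lie_class_eqP.
exact: LieScaleA.
Qed.
Lemma lie_scale1 : left_id 1 lie_scale.
Proof.
elim/lie_presW=> x; rewrite !lie_classE; apply/lie_class_eqP; exact: LieScale1.
Qed.
Lemma lie_scaleDr : right_distributive lie_scale lie_add.
Proof.
move=> a; elim/lie_presW=> x; elim/lie_presW=> y.
rewrite !lie_classE; apply/lie_class_eqP; exact: LieScaleDr.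
Qed.
Lemma lie_scaleDl x a b :
  lie_scale (a + b) x = lie_add (lie_scale a x) (lie_scale b x).
Proof.
elim/lie_presW: x => x; rewrite !lie_classE; apply/lie_class_eqP.
exact: LieScaleDl.
Qed.
HB.instance Definition _ := GRing.Zmodule_isLmodule.Build R lie_pres
  lie_scaleA lie_scale1 lie_scaleDr lie_scaleDl.

Lemma lie_bracket_linearl z : linear (lie_bracket^~ z).
Proof.
move=> a x y; change (lie_bracket (lie_add (lie_scale a x) y) z =
  lie_add (lie_scale a (lie_bracket x z)) (lie_bracket y z)).
elim/lie_presW: x => x; elim/lie_presW: y => y; elim/lie_presW: z => z.
rewrite !lie_classE; apply/lie_class_eqP; exact: LieBracketl.
Qed.
Lemma lie_bracket_linearr z : linear (lie_bracket z).
Proof.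
move=> a x y; change (lie_bracket z (lie_add (lie_scale a x) y) =
  lie_add (lie_scale a (lie_bracket z x)) (lie_bracket z y)).
elim/lie_presW: x => x; elim/lie_presW: y => y; elim/lie_presW: z => z.
rewrite !lie_classE; apply/lie_class_eqP; exact: LieBracketr.
Qed.
Lemma lie_bracketxx x : lie_bracket x x = 0.
Proof.
elim/lie_presW: x => x; rewrite !lie_classE; apply/lie_class_eqP.
exact: LieBracketxx.
Qed.
Lemma lie_jacobi x y z :
  lie_bracket x (lie_bracket y z) + lie_bracket y (lie_bracket z x)
    + lie_bracket z (lie_bracket x y) = 0.
Proof.
change (lie_add (lie_add (lie_bracket x (lie_bracket y z))
  (lie_bracket y (lie_bracket z x))) (lie_bracket z (lie_bracket x y)) =
  lie_class LieZero).
elim/lie_presW: x => x; elim/lie_presW: y => y; elim/lie_presW: z => z.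
rewrite !lie_classE; apply/lie_class_eqP; exact: LieJacobi.
Qed.
HB.instance Definition _ := Lmodule_isLieAlgebra.Build R lie_pres
  lie_bracket_linearl lie_bracket_linearr lie_bracketxx lie_jacobi.

Definition lie_gen (x : X) : lie_pres := lie_class (LieGen x).

(* The homogeneous component of degree k for the grading with the generators in
   degree 1. *)
Inductive lie_degree : nat -> lie_pres -> Prop :=
  | LieDegGen x : lie_degree 1 (lie_gen x)
  | LieDeg0 k : lie_degree k 0
  | LieDegLin k a x y :
      lie_degree k x -> lie_degree k y -> lie_degree k (a *: x + y)
  | LieDegBracket k l x y :
      lie_degree k x -> lie_degree l y -> lie_degree (k + l) (bracket x y).

End PresentedLieAlgebra.

(* The free Lie algebra on a set of generators. *)
Section FreeLie.
Variables (R : comNzRingType) (X : Type).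

Definition free_lie_rel (x y : lie_expr R X) : Prop := False.
Definition free_lie := lie_pres free_lie_rel.
HB.instance Definition _ := LieAlgebra.on free_lie.
Definition free_lie_gen (x : X) : free_lie := lie_gen free_lie_rel x.
Definition free_lie_degree : nat -> free_lie -> Prop :=
  @lie_degree R X free_lie_rel.

End FreeLie.

(* The free Lie algebra on a vector space, whose degree 1 part is that space. *)
Section FreeLieOn.
Variables (R : comNzRingType) (V : lmodType R).

Inductive free_lie_on_rel : lie_expr R V -> lie_expr R V -> Prop :=
  FreeLieOnRel a u v :
    free_lie_on_rel (LieGen R (a *: u + v))
      (LieAdd (LieScale a (LieGen R u)) (LieGen R v)).
Definition free_lie_on := lie_pres free_lie_on_rel.
HB.instance Definition _ := LieAlgebra.on free_lie_on.
Definition free_lie_on_gen (v : V) : free_lie_on := lie_gen free_lie_on_rel v.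
Definition free_lie_on_degree : nat -> free_lie_on -> Prop :=
  @lie_degree R V free_lie_on_rel.

Lemma free_lie_on_gen_linear : linear free_lie_on_gen.
Proof.
move=> a u v; change (lie_gen free_lie_on_rel (a *: u + v)
  = lie_add (lie_scale a (lie_gen free_lie_on_rel u))
      (lie_gen free_lie_on_rel v)).
rewrite /lie_gen lie_scaleE lie_addE; apply/lie_class_eqP/LieRel.
exact: FreeLieOnRel.
Qed.
HB.instance Definition _ := GRing.isLinear.Build R V free_lie_on *:%R
  free_lie_on_gen free_lie_on_gen_linear.

Definition bracket_gen (u v : V) : free_lie_on :=
  bracket (free_lie_on_gen u) (free_lie_on_gen v).

Lemma bracket_gen_alternating : alternating bracket_gen.
Proof.
rewrite /bracket_gen; split=> [w a u v|w a u v|v]; last exact: bracketxx.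
- by rewrite linearP; have /= -> := bracket_linearl (free_lie_on_gen w) a
    (free_lie_on_gen u) (free_lie_on_gen v).
- by rewrite linearP bracket_linearr.
Qed.

(* The linear map sending wedge u v to the bracket of u and v, which identifies
   the exterior square of V with the degree 2 part of the free Lie algebra. *)
Definition ext2_to_lie : ext2 V -> free_lie_on := ext2_lift bracket_gen.

Lemma ext2_to_lie_wedge u v : ext2_to_lie (wedge u v) = bracket_gen u v.
Proof. exact: ext2_lift_wedge bracket_gen_alternating u v. Qed.

Lemma ext2_to_lie_linear : linear ext2_to_lie.
Proof. exact: ext2_lift_linear bracket_gen_alternating. Qed.

End FreeLieOn.

Section LieQuotient.
Variables (R : pzRingType) (L : lieAlgType R).

Definition lie_ideal (S : L -> Prop) : {pred L} := fun x =>
  `[< forall I : submodClosed L,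
        (forall y z, z \in I -> bracket y z \in I) ->
        (forall y, S y -> y \in I) -> x \in I >].

Variable S : L -> Prop.

Lemma lie_idealP x : reflect
  (forall I : submodClosed L, (forall y z, z \in I -> bracket y z \in I) ->
     (forall y, S y -> y \in I) -> x \in I)
  (x \in lie_ideal S).
Proof. exact: asboolP. Qed.

Lemma lie_ideal_subsemimod : subsemimod_closed (lie_ideal S).
Proof.
split; [split|].
- by apply/lie_idealP=> I _ _; rewrite rpred0.
- move=> x y /lie_idealP Sx /lie_idealP Sy; apply/lie_idealP=> I bI SI.
  by rewrite rpredD ?Sx ?Sy.
- by move=> a x /lie_idealP Sx; apply/lie_idealP=> I bI SI; rewrite rpredZ ?Sx.
Qed.
HB.instance Definition _ :=
  GRing.isSubSemiModClosed.Build R L (lie_ideal S) lie_ideal_subsemimod.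

Lemma lie_ideal_gen x : S x -> x \in lie_ideal S.
Proof. by move=> Sx; apply/lie_idealP=> I _; apply. Qed.

Lemma lie_ideal_bracketr x y : y \in lie_ideal S -> bracket x y \in lie_ideal S.
Proof.
by move=> /lie_idealP Sy; apply/lie_idealP=> I bI SI; apply: (bI); apply: Sy.
Qed.

Lemma bracketC x y : bracket x y = - bracket y x :> L.
Proof.
have lD u v w : bracket (u + v) w = bracket u w + bracket v w :> L.
  by have := bracket_linearl w 1 u v; rewrite /= !scale1r.
have rD u v w : bracket w (u + v) = bracket w u + bracket w v :> L.
  by have := bracket_linearr w 1 u v; rewrite !scale1r.
apply/eqP; rewrite -addr_eq0; apply/eqP.
by have := bracketxx (x + y); rewrite lD !rD !bracketxx add0r addr0.
Qed.

Lemma lie_ideal_bracketl x y : x \in lie_ideal S -> bracket x y \in lie_ideal S.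
Proof.
by move=> Sx; rewrite bracketC -scaleN1r rpredZ ?lie_ideal_bracketr.
Qed.

Definition lie_quot := lquot (lie_ideal S).
HB.instance Definition _ := GRing.Lmodule.on lie_quot.

Definition lie_quot_pi (x : L) : lie_quot := lquot_pi (lie_ideal S) x.
Lemma lie_quot_pi_linear : linear lie_quot_pi.
Proof. exact: lquot_pi_linear. Qed.
HB.instance Definition _ :=
  GRing.isLinear.Build R L lie_quot *:%R lie_quot_pi lie_quot_pi_linear.

Definition lie_quot_bracket (x y : lie_quot) : lie_quot :=
  lie_quot_pi (bracket (repr x) (repr y)).

Lemma lie_quot_bracketE x y :
  lie_quot_bracket (lie_quot_pi x) (lie_quot_pi y) = lie_quot_pi (bracket x y).
Proof.
apply/lquot_eqP; set x' := repr _; set y' := repr _.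
have Sx : x' - x \in lie_ideal S by exact: lquot_repr_pi.
have Sy : y' - y \in lie_ideal S by exact: lquot_repr_pi.
have -> : bracket x' y' - bracket x y = bracket (x' - x) y' + bracket x (y' - y).
  have -> : x' - x = -1 *: x + x' by rewrite scaleN1r addrC.
  have -> : y' - y = -1 *: y + y' by rewrite scaleN1r addrC.
  have /= -> := bracket_linearl y' (-1) x x'.
  rewrite bracket_linearr !scaleN1r.
  rewrite [- bracket x y' + _]addrC [- bracket x y + _]addrC.
  by rewrite addrA addrNK.
by apply: rpredD; [apply: lie_ideal_bracketl|apply: lie_ideal_bracketr].
Qed.

Lemma lie_quotW (P : lie_quot -> Prop) :
  (forall x, P (lie_quot_pi x)) -> forall x, P x.
Proof. exact: lquotW. Qed.

Lemma lie_quot_bracket_linearl z : linear (lie_quot_bracket^~ z).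
Proof.
move=> a; elim/lie_quotW: z => z; elim/lie_quotW=> x; elim/lie_quotW=> y.
rewrite -linearP !lie_quot_bracketE -linearP.
by have /= -> := bracket_linearl z a x y.
Qed.
Lemma lie_quot_bracket_linearr z : linear (lie_quot_bracket z).
Proof.
move=> a; elim/lie_quotW: z => z; elim/lie_quotW=> x; elim/lie_quotW=> y.
by rewrite -linearP !lie_quot_bracketE -linearP bracket_linearr.
Qed.
Lemma lie_quot_bracketxx x : lie_quot_bracket x x = 0.
Proof.
by elim/lie_quotW: x => x; rewrite lie_quot_bracketE bracketxx raddf0.
Qed.
Lemma lie_quot_jacobi x y z :
  lie_quot_bracket x (lie_quot_bracket y z)
    + lie_quot_bracket y (lie_quot_bracket z x)
    + lie_quot_bracket z (lie_quot_bracket x y) = 0.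
Proof.
elim/lie_quotW: x => x; elim/lie_quotW: y => y; elim/lie_quotW: z => z.
rewrite !lie_quot_bracketE.
by rewrite -(linear0 lie_quot_pi) -(jacobi x y z) !linearD.
Qed.
HB.instance Definition _ := Lmodule_isLieAlgebra.Build R lie_quot
  lie_quot_bracket_linearl lie_quot_bracket_linearr
  lie_quot_bracketxx lie_quot_jacobi.

Definition lie_quot_degree (deg : nat -> L -> Prop) (k : nat) (y : lie_quot) :=
  exists2 x, deg k x & y = lie_quot_pi x.

End LieQuotient.

(* deg k and deg' k are the homogeneous components of degree k. *)
Definition graded_lie_isomorphic (R : pzRingType) (L L' : lieAlgType R)
    (deg : nat -> L -> Prop) (deg' : nat -> L' -> Prop) : Prop :=
  exists f : {linear L -> L'},
    [/\ bijective f,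
        forall x y, f (bracket x y) = bracket (f x) (f y)
      & forall k x, deg k x <-> deg' k (f x)].

(* The homology at B of A -> B -> C: the kernel of dout modulo the elements of
   this kernel that are in the image of din. *)
Section Homology.
Variables (R : pzRingType) (A B C : lmodType R).
Variables (din : {linear A -> B}) (dout : {linear B -> C}).

Definition cycle_pred : {pred B} := fun x => dout x == 0.

Lemma cycle_subsemimod : subsemimod_closed cycle_pred.
Proof.
have cE x : (x \in cycle_pred) = (dout x == 0) by [].
split; [split|].
- by rewrite cE linear0.
- by move=> x y; rewrite !cE linearD /= => /eqP-> /eqP->; rewrite addr0.
- by move=> a x; rewrite !cE linearZ /= => /eqP->; rewrite scaler0.
Qed.
HB.instance Definition _ :=
  GRing.isSubmodClosed.Build R B cycle_pred cycle_subsemimod.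

Record cycles := Cycle { cycle_val : B; _ : cycle_val \in cycle_pred }.
HB.instance Definition _ := [isSub for cycle_val].
HB.instance Definition _ := [Choice of cycles by <:].
HB.instance Definition _ := [SubChoice_isSubLmodule of cycles by <:].

Lemma cycleP (z : cycles) : dout (val z) = 0.
Proof. exact/eqP/(valP z). Qed.

Definition boundary_pred : {pred cycles} :=
  fun z => `[< exists a, din a = val z >].

Lemma boundary_predP z : reflect (exists a, din a = val z) (z \in boundary_pred).
Proof. exact: asboolP. Qed.

Lemma boundary_subsemimod : subsemimod_closed boundary_pred.
Proof.
split; [split|].
- by apply/boundary_predP; exists 0; rewrite !raddf0.
- move=> x y /boundary_predP[a ax] /boundary_predP[b yb].
  by apply/boundary_predP; exists (a + b); rewrite !raddfD /= ax yb.
- move=> k x /boundary_predP[a ax].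
  by apply/boundary_predP; exists (k *: a); rewrite !linearZ /= ax.
Qed.
HB.instance Definition _ :=
  GRing.isSubSemiModClosed.Build R cycles boundary_pred boundary_subsemimod.

Definition homology := lquot boundary_pred.
HB.instance Definition _ := GRing.Lmodule.on homology.

Definition homology_class (x : B) (dx : dout x = 0) : homology :=
  lquot_pi boundary_pred (Cycle (introT eqP dx)).

Definition homology_repr (x : homology) : B := val (repr x).

Lemma homology_reprP x : dout (homology_repr x) = 0.
Proof. exact: cycleP. Qed.

Lemma homology_reprK x : homology_class (homology_reprP x) = x.
Proof.
rewrite -[RHS]lquot_reprK; congr (lquot_pi _ _); exact: val_inj.
Qed.

Lemma homology_class_eqP x y (dx : dout x = 0) (dy : dout y = 0) :
  homology_class dx = homology_class dy <-> exists a, din a = x - y.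
Proof.
by split=> [/lquot_eqP /boundary_predP //|?]; apply/lquot_eqP/boundary_predP.
Qed.

Lemma homology_classP a x y z
    (dx : dout x = 0) (dy : dout y = 0) (dz : dout z = 0) :
  z = a *: x + y ->
  homology_class dz = a *: homology_class dx + homology_class dy.
Proof.
by move=> zE; rewrite -linearP; congr (lquot_pi _ _); apply: val_inj.
Qed.

Lemma homology_repr_class x (dx : dout x = 0) :
  exists a, din a = homology_repr (homology_class dx) - x.
Proof.
apply/(homology_class_eqP (homology_reprP _) dx); exact: homology_reprK.
Qed.

Lemma homology_repr_linear a x y : exists b,
  din b = homology_repr (a *: x + y)
            - (a *: homology_repr x + homology_repr y).
Proof.
have d0 : dout (a *: homology_repr x + homology_repr y) = 0.
  by rewrite linearP /= !homology_reprP scaler0 addr0.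
apply/(homology_class_eqP (homology_reprP _) d0); rewrite homology_reprK.
by rewrite (homology_classP (homology_reprP x) (homology_reprP y) d0 erefl)
  !homology_reprK.
Qed.

End Homology.

(* The inhomogeneous bar complex of G with trivial coefficients in rat, in
   degrees at most 3, and the dual complex of functions. The first differential
   of each complex is zero since the coefficients are trivial. *)
Section GroupHomology.
Variable G : groupType.
Implicit Types g h k : G.

Local Notation bar1 := {freeg G / rat}.
Local Notation bar2 := {freeg (G * G)%type / rat}.
Local Notation bar3 := {freeg (G * G * G)%type / rat}.

Definition bar_d1 : {linear bar1 -> rat^o} := fglift (fun _ : G => 0 : rat^o).

Definition bar_d2 : {linear bar2 -> bar1} := fglift (fun p : G * G =>
  let: (g, h) := p in << h >> - << (g * h)%g >> + << g >> : bar1).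

Definition bar_d3 : {linear bar3 -> bar2} := fglift (fun p : G * G * G =>
  let: (g, h, k) := p in
  << (h, k) >> - << ((g * h)%g, k) >> + << (g, (h * k)%g) >> - << (g, h) >>
  : bar2).

Definition cobar_d0_fun (a : rat^o) : G -> rat^o := fun=> 0.
Lemma cobar_d0_linear : linear cobar_d0_fun.
Proof. by move=> a x y; apply/funext=> g; rewrite /= scaler0 addr0. Qed.
HB.instance Definition _ :=
  GRing.isLinear.Build rat rat^o (G -> rat^o) *:%R cobar_d0_fun cobar_d0_linear.
Definition cobar_d0 : {linear rat^o -> (G -> rat^o)} := cobar_d0_fun.

Definition cobar_d1_fun (f : G -> rat^o) : G * G -> rat^o :=
  fun p => let: (g, h) := p in f h - f (g * h)%g + f g.
Lemma cobar_d1_linear : linear cobar_d1_fun.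
Proof.
move=> a x y; apply/funext=> -[g h] /=.
change ((a * x h + y h) - (a * x (g * h)%g + y (g * h)%g)
  + (a * x g + y g) = a * (x h - x (g * h)%g + x g)
  + (y h - y (g * h)%g + y g) :> rat); ring.
Qed.
HB.instance Definition _ := GRing.isLinear.Build rat (G -> rat^o)
  (G * G -> rat^o) *:%R cobar_d1_fun cobar_d1_linear.
Definition cobar_d1 : {linear (G -> rat^o) -> (G * G -> rat^o)} := cobar_d1_fun.

Definition cobar_d2_fun (c : G * G -> rat^o) : G * G * G -> rat^o := fun p =>
  let: (g, h, k) := p in
  c (h, k) - c ((g * h)%g, k) + c (g, (h * k)%g) - c (g, h).
Lemma cobar_d2_linear : linear cobar_d2_fun.
Proof.
move=> a x y; apply/funext=> -[[g h] k] /=.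
change ((a * x (h, k) + y (h, k))
    - (a * x ((g * h)%g, k) + y ((g * h)%g, k))
    + (a * x (g, (h * k)%g) + y (g, (h * k)%g)) - (a * x (g, h) + y (g, h))
  = a * (x (h, k) - x ((g * h)%g, k) + x (g, (h * k)%g) - x (g, h))
    + (y (h, k) - y ((g * h)%g, k) + y (g, (h * k)%g) - y (g, h)) :> rat).
ring.
Qed.
HB.instance Definition _ := GRing.isLinear.Build rat (G * G -> rat^o)
  (G * G * G -> rat^o) *:%R cobar_d2_fun cobar_d2_linear.
Definition cobar_d2 : {linear (G * G -> rat^o) -> (G * G * G -> rat^o)} :=
  cobar_d2_fun.

Definition homology1 := homology bar_d2 bar_d1.
Definition homology2 := homology bar_d3 bar_d2.
Definition cohomology1 := homology cobar_d0 cobar_d1.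
Definition cohomology2 := homology cobar_d1 cobar_d2.
HB.instance Definition _ := GRing.Lmodule.on homology1.
HB.instance Definition _ := GRing.Lmodule.on homology2.
HB.instance Definition _ := GRing.Lmodule.on cohomology1.
HB.instance Definition _ := GRing.Lmodule.on cohomology2.

(* The Kronecker pairings of cohomology with homology. *)
Definition kronecker1 (f : cohomology1) (x : homology1) : rat^o :=
  fglift (homology_repr f) (homology_repr x).
Definition kronecker2 (c : cohomology2) (z : homology2) : rat^o :=
  fglift (homology_repr c) (homology_repr z).

Lemma fglift_comp (K : choiceType) (V W : lmodType rat) (f : {linear V -> W})
    (e : K -> V) (x : {freeg K / rat}) :
  f (fglift e x) = fglift (fun i => f (e i)) x.
Proof.
rewrite -[x]freeg_sumE !raddf_sum /=; apply: eq_bigr => i _.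
by rewrite !liftU linearZ.
Qed.

Lemma fglift_linear_fun (K : choiceType) (x : {freeg K / rat}) a
    (f f' : K -> rat^o) :
  fglift (a *: f + f') x = a *: fglift f x + fglift f' x.
Proof.
rewrite -[x]freeg_sumE !raddf_sum /= -big_split /=.
apply: eq_bigr => i _; rewrite !liftU.
change (coeff i x * (a * f i + f' i)
  = a * (coeff i x * f i) + coeff i x * f' i :> rat); ring.
Qed.

Lemma fglift_cobar1 (f : G -> rat^o) (x : bar2) :
  fglift (cobar_d1 f) x = fglift f (bar_d2 x).
Proof.
rewrite fglift_comp; congr (fglift _ x); apply/funext=> -[g h].
by rewrite raddfD raddfB /= !liftU !scale1r.
Qed.

Lemma fglift_cobar2 (c : G * G -> rat^o) (x : bar3) :
  fglift (cobar_d2 c) x = fglift c (bar_d3 x).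
Proof.
rewrite fglift_comp; congr (fglift _ x); apply/funext=> -[[g h] k].
by rewrite raddfB raddfD raddfB /= !liftU !scale1r.
Qed.

Lemma fglift0 (K : choiceType) (x : {freeg K / rat}) :
  fglift (0 : K -> rat^o) x = 0.
Proof.
rewrite -[x]freeg_sumE !raddf_sum /= big1 // => i _.
by rewrite liftU; exact: mulr0.
Qed.

Lemma kronecker1E (f : G -> rat^o) (x : bar1)
    (df : cobar_d1 f = 0) (dx : bar_d1 x = 0) :
  kronecker1 (homology_class cobar_d0 df) (homology_class bar_d2 dx)
    = fglift f x.
Proof.
rewrite /kronecker1.
have [a] := homology_repr_class cobar_d0 df.
have [y] := homology_repr_class bar_d2 dx.
move/eqP; rewrite eq_sym subr_eq => /eqP-> /eqP.
rewrite eq_sym subr_eq => /eqP->.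
have -> : cobar_d0 a + f = f by apply/funext=> g; exact: add0r.
by rewrite raddfD /= -fglift_cobar1 df fglift0 add0r.
Qed.

Lemma kronecker2E (c : G * G -> rat^o) (z : bar2)
    (dc : cobar_d2 c = 0) (dz : bar_d2 z = 0) :
  kronecker2 (homology_class cobar_d1 dc) (homology_class bar_d3 dz)
    = fglift c z.
Proof.
rewrite /kronecker2.
have [f] := homology_repr_class cobar_d1 dc.
have := homology_reprP (homology_class bar_d3 dz).
have [y] := homology_repr_class bar_d3 dz.
move/eqP; rewrite eq_sym subr_eq => /eqP-> dz' /eqP.
rewrite eq_sym subr_eq => /eqP->.
rewrite -[cobar_d1 f]scale1r fglift_linear_fun scale1r fglift_cobar1 dz'.
by rewrite !raddf0 add0r raddfD /= -fglift_cobar2 dc fglift0 add0r.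
Qed.

Lemma kronecker1_linearl x : linear (kronecker1^~ x).
Proof.
move=> a f f'.
rewrite -[x]homology_reprK -[f]homology_reprK -[f']homology_reprK.
set df := homology_reprP f; set df' := homology_reprP f'.
have d0 : cobar_d1 (a *: homology_repr f + homology_repr f') = 0.
  by rewrite linearP /= df df' scaler0 addr0.
rewrite -(homology_classP _ df df' d0 erefl) !kronecker1E.
exact: fglift_linear_fun.
Qed.

Lemma kronecker1_linearr f : linear (kronecker1 f).
Proof.
move=> a x y.
rewrite -[f]homology_reprK -[x]homology_reprK -[y]homology_reprK.
set dx := homology_reprP x; set dy := homology_reprP y.
have d0 : bar_d1 (a *: homology_repr x + homology_repr y) = 0.
  by rewrite linearP [bar_d1 _]dx [bar_d1 (homology_repr y)]dy scaler0 addr0.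
by rewrite -(homology_classP _ dx dy d0 erefl) !kronecker1E linearP.
Qed.

Lemma kronecker2_linearl z : linear (kronecker2^~ z).
Proof.
move=> a c c'.
rewrite -[z]homology_reprK -[c]homology_reprK -[c']homology_reprK.
set dc := homology_reprP c; set dc' := homology_reprP c'.
have d0 : cobar_d2 (a *: homology_repr c + homology_repr c') = 0.
  by rewrite linearP /= dc dc' scaler0 addr0.
rewrite -(homology_classP _ dc dc' d0 erefl) !kronecker2E.
exact: fglift_linear_fun.
Qed.

Definition cup_cochain (f f' : G -> rat^o) : G * G -> rat^o :=
  fun p => f p.1 * f' p.2.

Lemma cocycle1M (f : G -> rat^o) g h :
  cobar_d1 f = 0 -> f (g * h)%g = f g + f h.
Proof.
move=> /(congr1 (@^~ (g, h))) /= /eqP.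
by rewrite addrAC subr_eq add0r addrC => /eqP<-.
Qed.

Lemma cup_cocycle (f f' : G -> rat^o) :
  cobar_d1 f = 0 -> cobar_d1 f' = 0 -> cobar_d2 (cup_cochain f f') = 0.
Proof.
move=> df df'; apply/funext=> -[[g h] k] /=.
rewrite /cup_cochain /= !cocycle1M //.
change (f h * f' k - (f g + f h) * f' k + f g * (f' h + f' k) - f g * f' h
  = 0 :> rat); ring.
Qed.

Definition cup (f f' : cohomology1) : cohomology2 :=
  homology_class cobar_d1 (cup_cocycle (homology_reprP f) (homology_reprP f')).

Lemma cup_alternating : alternating cup.
Proof.
split=> [w a u v|w a u v|v].
- have [b bE] := homology_repr_linear a u v.
  apply: homology_classP; apply/funext=> -[g h].
  have -> : homology_repr (a *: u + v)
      = a *: homology_repr u + homology_repr v.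
    by apply/eqP; rewrite -subr_eq0 -bE; apply/eqP/funext.
  change ((a * homology_repr u g + homology_repr v g) * homology_repr w h
    = a * (homology_repr u g * homology_repr w h)
      + homology_repr v g * homology_repr w h :> rat); ring.
- have [b bE] := homology_repr_linear a u v.
  apply: homology_classP; apply/funext=> -[g h].
  have -> : homology_repr (a *: u + v)
      = a *: homology_repr u + homology_repr v.
    by apply/eqP; rewrite -subr_eq0 -bE; apply/eqP/funext.
  change (homology_repr w g * (a * homology_repr u h + homology_repr v h)
    = a * (homology_repr w g * homology_repr u h)
      + homology_repr w g * homology_repr v h :> rat); ring.
- have d0 : cobar_d2 0 = 0 by rewrite raddf0.
  have <- : homology_class cobar_d1 d0 = 0.
    by rewrite -[RHS](raddf0 (lquot_pi _)); congr (lquot_pi _ _); apply: val_inj.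
  apply/homology_class_eqP; set f := homology_repr v.
  have df : cobar_d1 f = 0 by exact: homology_reprP.
  exists (fun g => - (f g * f g) / 2%:R); apply/funext=> -[g h].
  rewrite subr0 /= !cocycle1M //.
  change (- (f h * f h) / 2%:R - - ((f g + f h) * (f g + f h)) / 2%:R
     + - (f g * f g) / 2%:R = f g * f h :> rat); by field.
Qed.

(* The cup product as a linear map from the exterior square of H^1 to H^2. *)
Definition cup_map : ext2 cohomology1 -> cohomology2 := ext2_lift cup.

Lemma cup_map_linear : linear cup_map.
Proof. exact: ext2_lift_linear cup_alternating. Qed.

Lemma cup_map_wedge f f' : cup_map (wedge f f') = cup f f'.
Proof. exact: ext2_lift_wedge cup_alternating _ _. Qed.

(* The pairing between the exterior squares of H^1 and of H_1:
   (f /\ f', v /\ w) |-> f(v) f'(w) - f(w) f'(v). *)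
Definition kronecker_det (f f' : cohomology1) (v w : homology1) : rat^o :=
  kronecker1 f v * kronecker1 f' w - kronecker1 f w * kronecker1 f' v.
Definition ext2_pairing (xi : ext2 cohomology1) (om : ext2 homology1) : rat^o :=
  ext2_lift (fun f f' => ext2_lift (kronecker_det f f') om) xi.

(* The dual of the cup product map: cup_dual z is the element of the exterior
   square of H_1 whose pairing with each xi is the value of cup_map xi on z. It
   exists by cup_dualP; it is unique since ext2_pairing is nondegenerate on the
   exterior square of H_1. *)
Definition cup_dual (z : homology2) : ext2 homology1 :=
  xget 0 [set om | forall xi, ext2_pairing xi om = kronecker2 (cup_map xi) z].

Lemma bar_class_subproof g : bar_d1 << g >> = 0.
Proof. by rewrite /= liftU scaler0. Qed.
Definition bar_class g : homology1 :=
  homology_class bar_d2 (bar_class_subproof g).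

Let scale_ratE (a : rat) (x : rat^o) : a *: x = (a : rat^o) * x.
Proof. by []. Qed.

Lemma kronecker_det_alternating f f' : alternating (kronecker_det f f').
Proof.
split=> [w a u v|w a u v|v]; rewrite /kronecker_det; last by rewrite mulrC subrr.
- rewrite !kronecker1_linearr !scale_ratE; ring.
- rewrite !kronecker1_linearr !scale_ratE; ring.
Qed.

Lemma kronecker_det_alternatingl v w :
  alternating (fun f f' => kronecker_det f f' v w).
Proof.
split=> [f a f1 f2|f a f1 f2|f]; rewrite /kronecker_det.
- have /= -> := kronecker1_linearl v a f1 f2.
  have /= -> := kronecker1_linearl w a f1 f2.
  rewrite !scale_ratE; ring.
- have /= -> := kronecker1_linearl v a f1 f2.
  have /= -> := kronecker1_linearl w a f1 f2.
  rewrite !scale_ratE; ring.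
- by rewrite [X in _ - X]mulrC subrr.
Qed.

Lemma ext2_pairing_alternating om :
  alternating (fun f f' => ext2_lift (kronecker_det f f') om).
Proof.
pose L f f' := ext2_lift (kronecker_det f f').
have Llin f f' : linear (L f f').
  exact: ext2_lift_linear (kronecker_det_alternating f f').
have L0 f f' : L f f' 0 = 0 by exact: linear_fun0.
have Lw f f' u v : L f f' (wedge u v) = kronecker_det f f' u v.
  exact: ext2_lift_wedge (kronecker_det_alternating f f') u v.
change (alternating (fun f f' => L f f' om)).
split=> [f a f1 f2|f a f1 f2|f] /=; elim/ext2_ind: om => [|b u v om IH];
  rewrite ?L0 ?scaler0 ?addr0 //.
- rewrite !Llin !Lw IH.
  have [/(_ f a f1 f2) /= -> _ _] := kronecker_det_alternatingl u v.
  rewrite !scale_ratE; ring.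
- rewrite !Llin !Lw IH.
  have [_ /(_ f a f1 f2) /= -> _] := kronecker_det_alternatingl u v.
  rewrite !scale_ratE; ring.
- rewrite !Llin !Lw IH.
  have [_ _ /(_ f) /= ->] := kronecker_det_alternatingl u v.
  by rewrite scaler0 addr0.
Qed.

Lemma ext2_pairing_wedge f f' v w :
  ext2_pairing (wedge f f') (wedge v w) = kronecker_det f f' v w.
Proof.
rewrite /ext2_pairing ext2_lift_wedge; last exact: ext2_pairing_alternating.
by rewrite ext2_lift_wedge; last exact: kronecker_det_alternating.
Qed.

Lemma ext2_pairing_linearl om : linear (ext2_pairing^~ om).
Proof. exact: ext2_lift_linear (ext2_pairing_alternating om). Qed.

Lemma kronecker_cup f f' (z : bar2) (dz : bar_d2 z = 0) :
  kronecker2 (cup f f') (homology_class bar_d3 dz)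
    = fglift (cup_cochain (homology_repr f) (homology_repr f')) z.
Proof. exact: kronecker2E. Qed.

Lemma cup_dual_exists z :
  exists om, forall xi, ext2_pairing xi om = kronecker2 (cup_map xi) z.
Proof.
pose x := homology_repr z.
exists (fglift (fun p => 2%:R^-1 *: wedge (bar_class p.1) (bar_class p.2)) x).
move=> xi; have mu_lin := cup_map_linear.
elim/ext2_ind: xi => [|a f f' xi IH].
  rewrite (linear_fun0 mu_lin).
  rewrite (linear_fun0 (kronecker2_linearl z)).
  exact: linear_fun0 (ext2_pairing_linearl _).
have /= -> := ext2_pairing_linearl (fglift _ x) a (wedge f f') xi.
rewrite IH mu_lin cup_map_wedge.
have /= -> := kronecker2_linearl z a (cup f f') (cup_map xi).
congr (a *: _ + _); rewrite -(homology_reprK z) kronecker_cup -/x.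
rewrite /ext2_pairing ext2_lift_wedge; last exact: ext2_pairing_alternating.
pose L : {linear ext2 homology1 -> rat^o} :=
  HB.pack (ext2_lift (kronecker_det f f'))
    (GRing.isLinear.Build rat (ext2 homology1) rat^o *:%R _
      (ext2_lift_linear (kronecker_det_alternating f f'))).
rewrite -[ext2_lift _]/(L : _ -> _) fglift_comp.
have swap : fglift (cup_cochain (homology_repr f') (homology_repr f)) x
    = - fglift (cup_cochain (homology_repr f) (homology_repr f')) x.
  rewrite -!(kronecker_cup _ _ (homology_reprP z)).
  rewrite (alternatingC _ _ cup_alternating) homology_reprK.
  have := kronecker2_linearl z (-1) (cup f f') 0.
  by rewrite (linear_fun0 (kronecker2_linearl z)) !addr0 !scaleN1r.
have -> : (fun p : G * G => L (2%:R^-1 *: wedge (bar_class p.1) (bar_class p.2)))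
    = 2%:R^-1 *: ((-1 : rat) *: cup_cochain (homology_repr f') (homology_repr f)
        + cup_cochain (homology_repr f) (homology_repr f')) + 0.
  apply/funext=> -[g h]; rewrite addr0 linearZ; congr (_ *: _).
  rewrite /= ext2_lift_wedge; last exact: kronecker_det_alternating.
  have kE a' k : kronecker1 a' (bar_class k) = homology_repr a' k.
    rewrite -{1}(homology_reprK a') kronecker1E liftU scale1r //.
  rewrite /kronecker_det !kE.
  change (homology_repr f g * homology_repr f' h
    - homology_repr f h * homology_repr f' g
    = -1 * (homology_repr f' g * homology_repr f h)
      + homology_repr f g * homology_repr f' h :> rat); ring.
rewrite !fglift_linear_fun fglift0 addr0 swap !scale_ratE.
by field.
Qed.

Lemma cup_dualP z xi : ext2_pairing xi (cup_dual z) = kronecker2 (cup_map xi) z.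
Proof. exact: (xgetPex 0 (cup_dual_exists z)). Qed.

End GroupHomology.

(* A letter (x, false) stands for x and (x, true) for the inverse of x. *)
Section FreeGroup.
Variable X : choiceType.
Implicit Types u v w : seq (X * bool).

Inductive word_equiv : seq (X * bool) -> seq (X * bool) -> Prop :=
  | WordCancel u x b v : word_equiv (u ++ [:: (x, b); (x, ~~ b)] ++ v) (u ++ v)
  | WordRefl u : word_equiv u u
  | WordSym u v : word_equiv u v -> word_equiv v u
  | WordTrans u v w : word_equiv u v -> word_equiv v w -> word_equiv u w.

Definition word_equivb u v : bool := `[< word_equiv u v >].

Lemma word_equivb_class : equiv_class_of word_equivb.
Proof.
split=> [u|u v|v u w].
- by apply/asboolP; apply: WordRefl.
- by apply/asboolP/asboolP; apply: WordSym.
- by move=> /asboolP uv /asboolP vw; apply/asboolP; apply: WordTrans uv vw.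
Qed.
Canonical word_equivb_rel := EquivRelPack word_equivb_class.
Canonical word_equivb_encModRel := defaultEncModRel word_equivb.

Definition free_group := {eq_quot word_equivb}.
HB.instance Definition _ := EqQuotient.on free_group.
HB.instance Definition _ := Choice.on free_group.

Definition word_class u : free_group := \pi_free_group u.

Lemma word_class_eqP u v : word_class u = word_class v <-> word_equiv u v.
Proof.
rewrite /word_class; split=> [/eqP|uv]; first by rewrite piE => /asboolP.
by apply/eqP; rewrite piE; apply/asboolP.
Qed.

Lemma word_class_reprK (x : free_group) : word_class (repr x) = x.
Proof. exact: reprK. Qed.

Lemma word_repr_class u : word_equiv (repr (word_class u)) u.
Proof. by apply/word_class_eqP; rewrite word_class_reprK. Qed.

Lemma free_groupW (P : free_group -> Prop) :
  (forall u, P (word_class u)) -> forall x, P x.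
Proof. by move=> PU x; rewrite -[x]word_class_reprK. Qed.

Definition word_inv u := rev [seq (l.1, ~~ l.2) | l <- u].

Lemma word_equiv_cat u u' v v' :
  word_equiv u u' -> word_equiv v v' -> word_equiv (u ++ v) (u' ++ v').
Proof.
move=> uu' vv'; apply: (@WordTrans _ (u' ++ v)).
  elim: uu' v {vv'} => {u u'} [u x b w|u|u u' _ IH|u u' u'' _ IH _ IH'] v.
  - by rewrite -!catA; apply: WordCancel.
  - exact: WordRefl.
  - exact/WordSym/IH.
  - exact: WordTrans (IH v) (IH' v).
elim: vv' => {v v'} [v x b w|v|v v' _ IH|v v' v'' _ IH _ IH'].
- by rewrite !catA -catA; apply: WordCancel.
- exact: WordRefl.
- exact: WordSym.
- exact: WordTrans IH IH'.
Qed.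

Lemma word_inv_cat u v : word_inv (u ++ v) = word_inv v ++ word_inv u.
Proof. by rewrite /word_inv map_cat rev_cat. Qed.

Lemma word_equiv_inv u v : word_equiv u v -> word_equiv (word_inv u) (word_inv v).
Proof.
elim=> {u v} [u x b v|u|u v _ IH|u v w _ IH _ IH'].
- rewrite !word_inv_cat -catA.
  have -> : word_inv [:: (x, b); (x, ~~ b)] = [:: (x, b); (x, ~~ b)].
    by rewrite /word_inv /= negbK.
  exact: WordCancel.
- exact: WordRefl.
- exact: WordSym.
- exact: WordTrans IH IH'.
Qed.

Lemma word_invK : involutive word_inv.
Proof.
move=> u; rewrite /word_inv map_rev revK -map_comp -[RHS]map_id.
by apply: eq_map => -[x b] /=; rewrite negbK.
Qed.

Lemma word_equiv_invl u : word_equiv (word_inv u ++ u) [::].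
Proof.
elim: u => [|[x b] u IHu]; first exact: WordRefl.
rewrite -cat1s word_inv_cat -catA; apply: WordTrans IHu.
by have := WordCancel (word_inv u) x (~~ b) u; rewrite negbK.
Qed.

Lemma word_equiv_invr u : word_equiv (u ++ word_inv u) [::].
Proof. by rewrite -{1}(word_invK u); apply: word_equiv_invl. Qed.

Definition free_group_mul (x y : free_group) := word_class (repr x ++ repr y).
Definition free_group_inv (x : free_group) := word_class (word_inv (repr x)).

Lemma free_group_mulE u v :
  free_group_mul (word_class u) (word_class v) = word_class (u ++ v).
Proof. by apply/word_class_eqP/word_equiv_cat; apply: word_repr_class. Qed.
Lemma free_group_invE u :
  free_group_inv (word_class u) = word_class (word_inv u).
Proof. by apply/word_class_eqP/word_equiv_inv/word_repr_class. Qed.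

Lemma free_group_mulA : associative free_group_mul.
Proof.
elim/free_groupW=> u; elim/free_groupW=> v; elim/free_groupW=> w.
by rewrite !free_group_mulE catA.
Qed.
Lemma free_group_mul1g : left_id (word_class [::]) free_group_mul.
Proof. by elim/free_groupW=> u; rewrite free_group_mulE. Qed.
Lemma free_group_mulg1 : right_id (word_class [::]) free_group_mul.
Proof. by elim/free_groupW=> u; rewrite free_group_mulE cats0. Qed.
Lemma free_group_mulVg :
  left_inverse (word_class [::]) free_group_inv free_group_mul.
Proof.
elim/free_groupW=> u; rewrite free_group_invE free_group_mulE.
exact/word_class_eqP/word_equiv_invl.
Qed.
Lemma free_group_mulgV :
  right_inverse (word_class [::]) free_group_inv free_group_mul.
Proof.
elim/free_groupW=> u; rewrite free_group_invE free_group_mulE.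
exact/word_class_eqP/word_equiv_invr.
Qed.
HB.instance Definition _ := isGroup.Build free_group free_group_mulA
  free_group_mul1g free_group_mulg1 free_group_mulVg free_group_mulgV.

Definition free_group_gen (x : X) : free_group := word_class [:: (x, false)].

End FreeGroup.

Section Subgroups.
Variable G : groupType.

Inductive subgroup_gen (S : G -> Prop) : G -> Prop :=
  | SubgroupGen x : S x -> subgroup_gen S x
  | Subgroup1 : subgroup_gen S 1%g
  | SubgroupM x y : subgroup_gen S x -> subgroup_gen S y ->
      subgroup_gen S (x * y)%g
  | SubgroupV x : subgroup_gen S x -> subgroup_gen S x^-1%g.

Definition derived_subgroup : G -> Prop :=
  subgroup_gen (fun x => exists a b : G, x = [~ a, b]%g).

Definition normal_closure (r : G) : G -> Prop :=
  subgroup_gen (fun x => exists a : G, x = (r ^ a)%g).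

End Subgroups.

(* G is the group with generators X and the single relator r. *)
Definition one_relator_presentation (X : choiceType) (r : free_group X)
    (G : groupType) : Prop :=
  exists p : free_group X -> G,
    [/\ {morph p : u v / (u * v)%g}, forall g, exists u, p u = g
      & forall u, p u = 1%g <-> normal_closure r u].

(* Power series with integer coefficients in the non-commuting variables X; the
   value at w is the coefficient of the monomial w. *)
Definition ncseries (X : Type) : Type := seq X -> int.
HB.instance Definition _ X :=
  GRing.Zmodule.copy (ncseries X) (seq X -> int).

Section PowerSeries.
Variable X : eqType.
Implicit Types (f g h : ncseries X) (w : seq X).

Definition ncseries_one : ncseries X := fun w => (w == [::])%:R.
Definition ncseries_mul f g : ncseries X :=
  fun w => \sum_(i < (size w).+1) f (take i w) * g (drop i w).
Definition ncseries_shift (x : X) f : ncseries X := fun w => f (x :: w).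

Lemma ncseries_mul_nil f g : ncseries_mul f g [::] = f [::] * g [::].
Proof. by rewrite /ncseries_mul big_ord_recl big_ord0 addr0. Qed.

Lemma ncseries_mul_cons f g x w : ncseries_mul f g (x :: w)
  = f [::] * g (x :: w) + ncseries_mul (ncseries_shift x f) g w.
Proof. by rewrite /ncseries_mul big_ord_recl. Qed.

Lemma ncseries_mulDl : left_distributive ncseries_mul +%R.
Proof.
move=> f g h; apply/funext=> w.
change (ncseries_mul (f + g) h w = ncseries_mul f h w + ncseries_mul g h w).
by rewrite /ncseries_mul -big_split; apply: eq_bigr => i _; apply: mulrDl.
Qed.
Lemma ncseries_mulDr : right_distributive ncseries_mul +%R.
Proof.
move=> f g h; apply/funext=> w.
change (ncseries_mul f (g + h) w = ncseries_mul f g w + ncseries_mul f h w).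
by rewrite /ncseries_mul -big_split; apply: eq_bigr => i _; apply: mulrDr.
Qed.

Lemma ncseries_mul1l : left_id ncseries_one ncseries_mul.
Proof.
move=> f; apply/funext=> w; rewrite /ncseries_mul big_ord_recl big1 => [|i _].
  by rewrite take0 drop0 /ncseries_one eqxx mul1r addr0.
by case: w i => [[]//|x w] i; rewrite /ncseries_one /= mul0r.
Qed.
Lemma ncseries_mul1r : right_id ncseries_one ncseries_mul.
Proof.
move=> f; apply/funext=> w; rewrite /ncseries_mul big_ord_recr big1 => [|i _].
  by rewrite /= take_size drop_size /ncseries_one eqxx mulr1 add0r.
by rewrite /ncseries_one -size_eq0 size_drop subn_eq0 /= leqNgt ltn_ord mulr0.
Qed.

Lemma ncseries_mulA : associative ncseries_mul.
Proof.
move=> f g h; apply/funext=> w; elim: w f g => [|x w IHw] f g.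
  by rewrite !ncseries_mul_nil mulrA.
rewrite !ncseries_mul_cons !ncseries_mul_nil.
pose cf (a : int) f' : ncseries X := fun u => a * f' u.
have cfE a f' g' u : ncseries_mul (cf a f') g' u = a * ncseries_mul f' g' u.
  by rewrite /ncseries_mul mulr_sumr; apply: eq_bigr => i _; rewrite mulrA.
have -> : ncseries_shift x (ncseries_mul f g)
    = cf (f [::]) (ncseries_shift x g) + ncseries_mul (ncseries_shift x f) g.
  by apply/funext=> u; rewrite /ncseries_shift ncseries_mul_cons.
rewrite ncseries_mulDl.
rewrite [(ncseries_mul _ h + _) w]/(ncseries_mul _ h w + ncseries_mul _ h w).
by rewrite -IHw cfE mulrDr !mulrA !addrA.
Qed.

Lemma ncseries_one_neq0 : ncseries_one != 0.
Proof. by apply/eqP=> /(congr1 (@^~ [::])). Qed.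

HB.instance Definition _ := GRing.Zmodule_isNzRing.Build (ncseries X)
  ncseries_mulA ncseries_mul1l ncseries_mul1r ncseries_mulDl ncseries_mulDr
  ncseries_one_neq0.

Definition ncseries_var (x : X) : ncseries X := fun w => (w == [:: x])%:R.

(* The series 1 - x + x ^ 2 - x ^ 3 + ... *)
Definition ncseries_geom (x : X) : ncseries X :=
  fun w => if all (pred1 x) w then (-1) ^+ size w else 0.

Lemma ncseries_geom_cons x y w :
  ncseries_geom x (y :: w) = if y == x then - ncseries_geom x w else 0.
Proof.
rewrite /ncseries_geom /=; case: eqP => //= _.
by case: ifP => _; rewrite ?oppr0 // exprS mulN1r.
Qed.

Lemma ncseries_var_geom x : ncseries_var x * ncseries_geom x = 1 - ncseries_geom x.
Proof.
apply/funext=> w; change (ncseries_mul (ncseries_var x) (ncseries_geom x) w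
  = ncseries_one w - ncseries_geom x w).
case: w => [|y w]; first by rewrite ncseries_mul_nil mul0r.
rewrite ncseries_mul_cons mul0r add0r ncseries_geom_cons.
have -> : ncseries_shift y (ncseries_var x) = if y == x then 1 else 0.
  apply/funext=> u; rewrite /ncseries_shift /ncseries_var eqseq_cons.
  by case: eqP.
rewrite [ncseries_one _]/(0 : int) sub0r; case: eqP => _.
  by rewrite ncseries_mul1l opprK.
by rewrite oppr0 /ncseries_mul big1 // => i _; apply: mul0r.
Qed.

Lemma ncseries_geom_var x : ncseries_geom x * ncseries_var x = 1 - ncseries_geom x.
Proof.
apply/funext=> w; change (ncseries_mul (ncseries_geom x) (ncseries_var x) w
  = ncseries_one w - ncseries_geom x w).
elim: w => [|y w IHw]; first by rewrite ncseries_mul_nil mulr0.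
rewrite ncseries_mul_cons ncseries_geom_cons.
have -> : ncseries_shift y (ncseries_geom x)
    = if y == x then - ncseries_geom x else 0.
  apply/funext=> u; rewrite /ncseries_shift ncseries_geom_cons.
  by case: eqP.
rewrite [ncseries_geom x [::]]/(1 : int) mul1r {1}/ncseries_var eqseq_cons.
rewrite [ncseries_one (_ :: _)]/(0 : int) sub0r; case: eqP => _ /=.
  have -> : ncseries_mul (- ncseries_geom x) (ncseries_var x) w
      = - ncseries_mul (ncseries_geom x) (ncseries_var x) w.
    by rewrite -[LHS]/((- ncseries_geom x * ncseries_var x) w) mulNr.
  by rewrite IHw opprK opprB addrCA subrr addr0.
by rewrite oppr0 add0r /ncseries_mul big1 // => i _; apply: mul0r.
Qed.

Definition magnus_letter (l : X * bool) : ncseries X :=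
  if l.2 then ncseries_geom l.1 else 1 + ncseries_var l.1.

Lemma magnus_letterV x b : magnus_letter (x, b) * magnus_letter (x, ~~ b) = 1.
Proof.
case: b; rewrite /magnus_letter /=.
  by rewrite mulrDr mulr1 ncseries_geom_var addrC subrK.
by rewrite mulrDl mul1r ncseries_var_geom addrC subrK.
Qed.

Definition magnus_word (u : seq (X * bool)) : ncseries X :=
  \prod_(l <- u) magnus_letter l.

End PowerSeries.

(* The Magnus expansion, restricted to the free group: it is multiplicative and
   sends the generator x to 1 + x, see magnusM and magnus_gen. *)
Definition magnus (X : choiceType) (u : free_group X) : ncseries X :=
  magnus_word (repr u).

Section Magnus.
Variable X : choiceType.
Implicit Types u v : free_group X.

Lemma magnus_word_equiv (w w' : seq (X * bool)) :
  word_equiv w w' -> magnus_word w = magnus_word w'.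
Proof.
elim=> {w w'} [u x b v|//|u v _ ->//|u v w _ -> _ ->//].
rewrite /magnus_word !big_cat /= !big_cons big_nil.
by rewrite mulr1 magnus_letterV mul1r.
Qed.

Lemma magnus_class (w : seq (X * bool)) : magnus (word_class w) = magnus_word w.
Proof. exact/magnus_word_equiv/word_repr_class. Qed.

Lemma magnusM : {morph @magnus X : u v / (u * v)%g >-> u * v}.
Proof.
elim/free_groupW=> u; elim/free_groupW=> v.
rewrite [(_ * _)%g]free_group_mulE !magnus_class.
exact: big_cat.
Qed.

Lemma magnus1 : magnus (1%g : free_group X) = 1.
Proof.
by have := magnus_class [::]; rewrite /magnus_word big_nil.
Qed.

Lemma magnus_gen (x : X) : magnus (free_group_gen x) = 1 + ncseries_var x.
Proof. by rewrite magnus_class /magnus_word big_seq1. Qed.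

End Magnus.

Definition magnus_coef2 (n : nat) (r : free_group 'I_n) (i j : 'I_n) : int :=
  magnus r [:: i; j].

(* The degree 2 part of the Magnus expansion of an element r of the derived
   subgroup, as an element of the free Lie algebra. *)
Definition magnus_lie2 (n : nat) (r : free_group 'I_n) : free_lie rat 'I_n :=
  \sum_(i < n) \sum_(j < n | (i < j)%N)
    (magnus_coef2 r i j)%:~R *: bracket (free_lie_gen rat i) (free_lie_gen rat j).

Section Holonomy.
Variable G : groupType.

(* The image of the dual of the cup product map, in degree 2 of the free Lie
   algebra on H_1. *)
Definition holonomy_relation (y : free_lie_on (homology1 G)) : Prop :=
  exists z : homology2 G, y = ext2_to_lie (cup_dual z).

Definition holonomy_lie := lie_quot holonomy_relation.
HB.instance Definition _ := LieAlgebra.on holonomy_lie.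

Definition holonomy_degree : nat -> holonomy_lie -> Prop :=
  lie_quot_degree (@free_lie_on_degree rat (homology1 G)).

End Holonomy.

(* Main.v *)
Require Import Defs.
From HB Require Import structures.
From mathcomp Require Import all_boot all_algebra.
From mathcomp Require Import boolp classical_sets functions.
From mathcomp Require Import ring.
From mathcomp.multinomials Require Import freeg.

(* The cup products of a one-relator group G = F / N, with N the normal closure
   of the relator r, are computed by the Magnus coefficients of degree 2: if f
   and f' are homomorphisms from G to Q, pulled back to F, then
   phi u := sum_(i, j) eps_ij(u) f(x_i) f'(x_j) satisfies
   phi (u v) = phi u + phi v + f(u) f'(v). Hence phi is additive and
   conjugation invariant on N, so phi t = k phi r for t in N a product of
   conjugates of r and its inverse with exponent sum k. Let s be a section of
   F -> G; then s(g) s(h) = s(gh) t(g, h) with t(g, h) in N, so f(g) f'(h)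
   equals k(g, h) phi r up to a coboundary, where k depends on neither f nor f':
   the cup product of f and f' takes the value lambda(z) phi r on every
   z in H_2(G).
   - If r is in [F, F], then <r> is the boundary of some w in the bar complex
     of F, and the image of w in the bar complex of G is, up to a degenerate
     chain, a cycle on which the cup product is - phi r. So the image of the
     dual cup product is spanned by M_2(r).
   - Otherwise some exponent sum psi satisfies psi r <> 0, so that k is the
     coboundary of psi o s / psi r and lambda = 0: there are no relations, and
     H_1(G; Q) has dimension n - 1. *)

Set Implicit Arguments.
Unset Strict Implicit.
Unset Printing Implicit Defensive.

Import GRing.Theory.

Local Open Scope ring_scope.

(** * Morphisms of Lie algebras out of quotients and presentations *)

Section LieMorphisms.
Variable R : comNzRingType.

Definition lie_morphism (L M : lieAlgType R) (f : L -> M) : Prop :=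
  linear f /\ forall x y, f (bracket x y) = bracket (f x) (f y).

Definition linear_pack (V W : lmodType R) (f : V -> W) (lf : linear f) :
  {linear V -> W} := HB.pack f (GRing.isLinear.Build R V W *:%R f lf).

Lemma graded_lie_isomorphicI (L M : lieAlgType R) (deg : nat -> L -> Prop)
    (deg' : nat -> M -> Prop) (f : L -> M) (g : M -> L) :
  lie_morphism f -> cancel f g -> cancel g f ->
  (forall k x, deg k x -> deg' k (f x)) ->
  (forall k y, deg' k y -> deg k (g y)) ->
  graded_lie_isomorphic deg deg'.
Proof.
move=> [lf bf] fK gK degf degg; exists (linear_pack lf); split=> //.
- by exists g.
- by move=> k x; split=> [/degf//|/degg]; rewrite /= fK.
Qed.

Lemma lie_morphism_comp (L M N : lieAlgType R) (f : L -> M) (g : M -> N) :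
  lie_morphism f -> lie_morphism g -> lie_morphism (g \o f).
Proof.
move=> [lf bf] [lg bg]; split=> [a x y|x y] /=; first by rewrite lf lg.
by rewrite bf bg.
Qed.

Lemma lie_morphism0 (L M : lieAlgType R) (f : L -> M) :
  lie_morphism f -> f 0 = 0.
Proof. by case=> lf _; exact: linear_fun0. Qed.

Lemma lie_morphismZ (L M : lieAlgType R) (f : L -> M) a x :
  lie_morphism f -> f (a *: x) = a *: f x.
Proof.
move=> fm; have [lf _] := fm; have := lf a x 0.
by rewrite !addr0 lie_morphism0 // addr0.
Qed.

Lemma lie_morphismD (L M : lieAlgType R) (f : L -> M) x y :
  lie_morphism f -> f (x + y) = f x + f y.
Proof. by move=> [lf _]; have := lf 1 x y; rewrite !scale1r. Qed.

Lemma lie_morphism_sum (L M : lieAlgType R) (f : L -> M) (I : finType)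
    (P : pred I) (F : I -> L) : lie_morphism f ->
  f (\sum_(i | P i) F i) = \sum_(i | P i) f (F i).
Proof. by case=> lf _; exact: (raddf_sum (linear_pack lf)). Qed.

Lemma lie_quot_pi_morphism (L : lieAlgType R) (S : L -> Prop) :
  lie_morphism (lie_quot_pi S).
Proof.
by split=> [|x y]; [exact: lie_quot_pi_linear|rewrite -lie_quot_bracketE].
Qed.

Section QuotientMorphism.
Variables (L M : lieAlgType R) (S : L -> Prop) (f : L -> M).
Hypotheses (fm : lie_morphism f) (fS : forall y, S y -> f y = 0).

(** The kernel of a Lie morphism is an ideal, and it contains [S]. *)
Lemma lie_ideal_ker x : x \in lie_ideal S -> f x = 0.
Proof.
have [lf bf] := fm.
pose K : {pred L} := fun x => f x == 0.
have KE y : (y \in K) = (f y == 0) by [].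
have Kclosed : subsemimod_closed K.
  split; [split|].
  - by rewrite KE lie_morphism0.
  - move=> u v; rewrite !KE => /eqP fu /eqP fv.
    by rewrite lie_morphismD // fu fv addr0.
  - by move=> a u; rewrite !KE lie_morphismZ // => /eqP->; rewrite scaler0.
pose KU : submodClosed L :=
  HB.pack K (GRing.isSubSemiModClosed.Build R L K Kclosed).
move/lie_idealP=> /(_ KU) Kx; apply/eqP/Kx => [y z|y /fS fy]; rewrite !KE ?fy //.
move=> /eqP fz; rewrite bf fz.
by rewrite (linear_fun0 (bracket_linearr (f y))).
Qed.

Lemma lie_quot_liftE x : lquot_lift f (lie_quot_pi S x) = f x.
Proof.
have [lf _] := fm; apply: lquot_liftE; last exact: lie_ideal_ker.
exact: (raddfB (linear_pack lf)).
Qed.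

Lemma lie_quot_lift_morphism :
  lie_morphism (lquot_lift f : lie_quot S -> M).
Proof.
have [lf bf] := fm; split=> [a|]; elim/lie_quotW=> x; elim/lie_quotW=> y.
  by rewrite -linearP !lie_quot_liftE lf.
by rewrite [bracket _ _]lie_quot_bracketE !lie_quot_liftE bf.
Qed.

Lemma lie_quot_lift_degree (deg : nat -> L -> Prop) (deg' : nat -> M -> Prop) :
  (forall k x, deg k x -> deg' k (f x)) ->
  forall k x, lie_quot_degree (S := S) deg k x -> deg' k (lquot_lift f x).
Proof. by move=> degf k _ [x dx ->]; rewrite lie_quot_liftE; apply: degf. Qed.

End QuotientMorphism.

(** It is enough to compare generators of the two ideals: both composites with the projections then
    descend to the quotients, where they are mutually inverse on representatives. *)
Lemma graded_lie_isomorphic_quot (L M : lieAlgType R) (deg : nat -> L -> Prop)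
    (deg' : nat -> M -> Prop) (S : L -> Prop) (S' : M -> Prop)
    (f : L -> M) (g : M -> L) :
  lie_morphism f -> lie_morphism g -> cancel f g -> cancel g f ->
  (forall k x, deg k x -> deg' k (f x)) ->
  (forall k y, deg' k y -> deg k (g y)) ->
  (forall x, S x -> f x \in lie_ideal S') ->
  (forall y, S' y -> g y \in lie_ideal S) ->
  graded_lie_isomorphic (lie_quot_degree (S := S) deg)
    (lie_quot_degree (S := S') deg').
Proof.
move=> fm gm fK gK degf degg fS gS'.
have Fm := lie_morphism_comp fm (lie_quot_pi_morphism S').
have Gm := lie_morphism_comp gm (lie_quot_pi_morphism S).
have FS x : S x -> (lie_quot_pi S' \o f) x = 0.
  move=> /fS fx; rewrite -(linear0 (lie_quot_pi S')).
  by apply/lquot_eqP; rewrite subr0.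
have GS' y : S' y -> (lie_quot_pi S \o g) y = 0.
  move=> /gS' gy; rewrite -(linear0 (lie_quot_pi S)).
  by apply/lquot_eqP; rewrite subr0.
pose F : lie_quot S -> lie_quot S' := lquot_lift (lie_quot_pi S' \o f).
pose F' : lie_quot S' -> lie_quot S := lquot_lift (lie_quot_pi S \o g).
apply: (@graded_lie_isomorphicI _ _ _ _ F F').
- exact: lie_quot_lift_morphism Fm FS.
- elim/lie_quotW=> x; rewrite /F (lie_quot_liftE Fm FS).
  by rewrite [LHS](lie_quot_liftE Gm GS') /= fK.
- elim/lie_quotW=> y; rewrite /F' (lie_quot_liftE Gm GS').
  by rewrite [LHS](lie_quot_liftE Fm FS) /= gK.
- by apply: lie_quot_lift_degree => // k x dx; exists (f x) => //; exact: degf.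
- by apply: lie_quot_lift_degree => // k y dy; exists (g y) => //; exact: degg.
Qed.

Section PresentationMorphism.
Variables (X : Type) (L : lieAlgType R) (g : X -> L).

Fixpoint lie_eval (e : lie_expr R X) : L :=
  match e with
  | LieGen x => g x
  | LieZero => 0
  | LieOpp x => - lie_eval x
  | LieAdd x y => lie_eval x + lie_eval y
  | LieScale a x => a *: lie_eval x
  | LieBracket x y => bracket (lie_eval x) (lie_eval y)
  end.

Variable rel : lie_expr R X -> lie_expr R X -> Prop.
Hypothesis g_rel : forall x y, rel x y -> lie_eval x = lie_eval y.

Lemma lie_eval_cong x y : lie_cong rel x y -> lie_eval x = lie_eval y.
Proof.
elim=> {x y} //=.
- by move=> x y z _ -> _ ->.
- by move=> x y _ ->.
- by move=> x x' y y' _ -> _ ->.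
- by move=> a x y _ ->.
- by move=> x x' y y' _ -> _ ->.
- by move=> x y z; rewrite addrA.
- by move=> x y; rewrite addrC.
- by move=> x; rewrite add0r.
- by move=> x; rewrite addNr.
- by move=> a b x; rewrite scalerA.
- by move=> x; rewrite scale1r.
- by move=> a x y; rewrite scalerDr.
- by move=> x a b; rewrite scalerDl.
- by move=> z a x y; exact: bracket_linearl.
- by move=> z a x y; exact: bracket_linearr.
- by move=> x; exact: bracketxx.
- by move=> x y z; exact: jacobi.
Qed.

Definition lie_pres_lift (x : lie_pres rel) : L := lie_eval (repr x).

Lemma lie_pres_liftE e : lie_pres_lift (lie_class rel e) = lie_eval e.
Proof. exact/lie_eval_cong/lie_repr_class. Qed.

Lemma lie_pres_lift_gen x : lie_pres_lift (lie_gen rel x) = g x.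
Proof. exact: lie_pres_liftE. Qed.

Lemma lie_pres_lift_morphism : lie_morphism lie_pres_lift.
Proof.
split=> [a|]; elim/lie_presW=> x; elim/lie_presW=> y.
  have -> : a *: lie_class rel x + lie_class rel y
      = lie_class rel (LieAdd (LieScale a x) y).
    by rewrite -lie_addE -lie_scaleE.
  by rewrite !lie_pres_liftE.
by rewrite [bracket _ _]lie_bracketE !lie_pres_liftE.
Qed.

Lemma lie_pres_lift_degree (deg : nat -> L -> Prop) :
  (forall x, deg 1%N (g x)) -> (forall k, deg k 0) ->
  (forall k a x y, deg k x -> deg k y -> deg k (a *: x + y)) ->
  (forall k l x y, deg k x -> deg l y -> deg (k + l)%N (bracket x y)) ->
  forall k x, lie_degree (rel := rel) k x -> deg k (lie_pres_lift x).
Proof.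
have [fl fb] := lie_pres_lift_morphism.
move=> dg d0 dl db k x; elim=> {k x}.
- by move=> x; rewrite lie_pres_lift_gen.
- by move=> k; rewrite (linear_fun0 fl).
- by move=> k a x y _ dx _ dy; rewrite fl; exact: dl.
- by move=> k l x y _ dx _ dy; rewrite fb; exact: db.
Qed.

End PresentationMorphism.

Lemma lie_morphism_ext (X : Type) (L : lieAlgType R)
    (rel : lie_expr R X -> lie_expr R X -> Prop) (f f' : lie_pres rel -> L) :
  lie_morphism f -> lie_morphism f' ->
  (forall x, f (lie_gen rel x) = f' (lie_gen rel x)) -> f =1 f'.
Proof.
move=> fm fm' fg; have [fl fb] := fm; have [fl' fb'] := fm'.
elim/lie_presW; elim=> [x||x IH|x IHx y IHy|a x IH|x IHx y IHy].
- exact: fg.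
- by rewrite [lie_class _ _]/(0 : lie_pres rel) !lie_morphism0.
- rewrite -lie_oppE -[lie_opp _]/(- lie_class rel x) -scaleN1r.
  by rewrite !lie_morphismZ // IH.
- rewrite -lie_addE -[lie_add _ _]/(lie_class rel x + lie_class rel y).
  by rewrite !lie_morphismD // IHx IHy.
- rewrite -lie_scaleE -[lie_scale _ _]/(a *: lie_class rel x).
  by rewrite !lie_morphismZ // IH.
- rewrite -lie_bracketE.
  rewrite -[lie_bracket _ _]/(bracket (lie_class rel x) (lie_class rel y)).
  by rewrite fb fb' IHx IHy.
Qed.

End LieMorphisms.

(** * Magnus coefficients of degrees 1 and 2 *)

Section MagnusCoefficients.
Variable n : nat.
Implicit Types (u v : free_group 'I_n) (i j : 'I_n).

(** The degree 1 coefficient is the exponent sum of the generator [i], see [exponent_word]. *)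
Definition exponent i u : rat := (magnus u [:: i])%:~R.
Definition eps2 i j u : rat := (magnus_coef2 u i j)%:~R.

Lemma magnus_nil u : magnus u [::] = 1.
Proof.
elim/free_groupW: u => w; rewrite magnus_class /magnus_word.
elim: w => [|[x b] w IHw]; first by rewrite big_nil.
rewrite big_cons.
change (ncseries_mul (magnus_letter (x, b))
  (\prod_(l <- w) magnus_letter l) [::] = 1).
rewrite ncseries_mul_nil IHw mulr1.
by case: b.
Qed.

Lemma exponentM i u v : exponent i (u * v)%g = exponent i u + exponent i v.
Proof.
rewrite /exponent magnusM.
change ((ncseries_mul (magnus u) (magnus v) [:: i])%:~R
  = (magnus u [:: i])%:~R + (magnus v [:: i])%:~R :> rat).
rewrite /ncseries_mul !big_ord_recl big_ord0 /= !magnus_nil.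
by rewrite mul1r mulr1 addr0 addrC rmorphD.
Qed.

(** The word [ij] can be cut in three places. The outer cuts meet a constant term, equal to 1 by
    [magnus_nil]; the middle cut gives the product of exponents. *)
Lemma eps2M i j u v :
  eps2 i j (u * v)%g = eps2 i j u + eps2 i j v + exponent i u * exponent j v.
Proof.
rewrite /eps2 /magnus_coef2 /exponent magnusM.
change ((ncseries_mul (magnus u) (magnus v) [:: i; j])%:~R
  = (magnus u [:: i; j])%:~R + (magnus v [:: i; j])%:~R
    + (magnus u [:: i])%:~R * (magnus v [:: j])%:~R :> rat).
rewrite /ncseries_mul !big_ord_recl big_ord0 /= !magnus_nil.
by rewrite mul1r mulr1 addr0 !rmorphD rmorphM /=; ring.
Qed.

Lemma exponent_gen i j : exponent i (free_group_gen j) = (i == j)%:R.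
Proof.
rewrite /exponent magnus_gen.
change ((0 + ([:: i] == [:: j])%:R : int)%:~R = (i == j)%:R :> rat).
by rewrite add0r eqseq_cons andbT; case: eqP.
Qed.

End MagnusCoefficients.

(** * Additive functions on groups, derived subgroups and normal closures *)

Section AdditiveFunctions.
Variables (H : groupType) (V : zmodType) (c : H -> V).
Hypothesis cM : {morph c : u v / (u * v)%g >-> u + v}.

Lemma additive_fun1 : c 1%g = 0.
Proof.
by have /eqP := cM 1%g 1%g; rewrite mulg1 -subr_eq subrr eq_sym => /eqP.
Qed.

Lemma additive_funV u : c u^-1%g = - c u.
Proof. by apply/eqP; rewrite -addr_eq0 -cM mulVg additive_fun1. Qed.

Lemma additive_fun_subgroup (S : H -> Prop) :
  (forall u, S u -> c u = 0) -> forall u, subgroup_gen S u -> c u = 0.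
Proof.
move=> cS u; elim=> {u} [u /cS //||u v _ cu _ cv|u _ cu].
- exact: additive_fun1.
- by rewrite cM cu cv addr0.
- by rewrite additive_funV cu oppr0.
Qed.

Lemma additive_fun_derived u : derived_subgroup u -> c u = 0.
Proof.
apply: additive_fun_subgroup => _ [a [b ->]].
by rewrite /commg /conjg !cM !additive_funV [c a + c b]addrC addKr addNr.
Qed.

Lemma additive_fun_normal_closure r u :
  c r = 0 -> normal_closure r u -> c u = 0.
Proof.
move=> cr; apply: additive_fun_subgroup => _ [a ->].
by rewrite /conjg !cM !additive_funV cr add0r addNr.
Qed.

End AdditiveFunctions.

(** Both sides are additive in [u] and agree on generators, hence on their inverses and on all
    words. *)
Lemma additive_fun_free_group (n : nat) (V : lmodType rat)
    (c : free_group 'I_n -> V) : {morph c : u v / (u * v)%g >-> u + v} ->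
  forall u, c u = \sum_(i < n) exponent i u *: c (free_group_gen i).
Proof.
move=> cM.
have eM i : {morph @exponent n i : u v / (u * v)%g >-> u + v}.
  exact: exponentM.
elim/free_groupW; elim=> [|[x b] w IHw].
  rewrite -[word_class [::]]/(1%g : free_group _) (additive_fun1 cM).
  by rewrite big1 // => i _; rewrite (additive_fun1 (eM i)) scale0r.
pose l : free_group 'I_n := word_class [:: (x, b)].
have -> : word_class ((x, b) :: w) = (l * word_class w)%g.
  by rewrite [(_ * _)%g]free_group_mulE.
rewrite cM IHw.
have -> : c l = \sum_(i < n) exponent i l *: c (free_group_gen i).
  have gx : c (free_group_gen x)
      = \sum_(i < n) exponent i (free_group_gen x) *: c (free_group_gen i).
    rewrite (bigD1 x) //= exponent_gen eqxx scale1r big1 ?addr0 // => i.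
    by move=> /negPf ix; rewrite exponent_gen ix scale0r.
  have [bT|bF] := boolP b; last first.
    by rewrite -[l]/(word_class [:: (x, b)]) (negPf bF).
  have -> : l = (free_group_gen x)^-1%g.
    by rewrite [(_^-1)%g]free_group_invE /l bT.
  rewrite (additive_funV cM) {1}gx -sumrN.
  by apply: eq_bigr => i _; rewrite (additive_funV (eM i)) scaleNr.
by rewrite -big_split; apply: eq_bigr => i _; rewrite eM scalerDl.
Qed.

(** The shuffle combination [q] is additive on the free group, so it vanishes on commutators, as do
    the exponents. *)
Lemma eps2_antisym (n : nat) (r : free_group 'I_n) i j :
  derived_subgroup r -> eps2 i j r = - eps2 j i r.
Proof.
move=> dr.
have exp0 k : exponent k r = 0.
  by apply: additive_fun_derived dr => u v; exact: exponentM.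
pose q u := eps2 i j u + eps2 j i u - exponent i u * exponent j u.
have qr : q r = 0.
  by apply: additive_fun_derived dr => u v; rewrite /q !eps2M !exponentM; ring.
by apply/eqP; rewrite -addr_eq0 -qr /q !exp0 mul0r subr0.
Qed.

Lemma exponent_word (n : nat) (w : seq ('I_n * bool)) i :
  exponent i (word_class w)
    = (count_mem (i, false) w)%:R - (count_mem (i, true) w)%:R.
Proof.
have eM : {morph @exponent n i : u v / (u * v)%g >-> u + v} by exact: exponentM.
elim: w => [|[x b] w IHw].
  by rewrite /= subr0 -[word_class _]/(1%g : free_group _) (additive_fun1 eM).
have -> : word_class ((x, b) :: w) = (word_class [:: (x, b)] * word_class w)%g.
  by rewrite [(_ * _)%g]free_group_mulE.
rewrite eM IHw /= !xpair_eqE !natrD.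
have -> : exponent i (word_class [:: (x, b)]) = (-1) ^+ b * (x == i)%:R.
  case: b; last by rewrite mul1r eq_sym; exact: exponent_gen.
  have -> : word_class [:: (x, true)] = (free_group_gen x)^-1%g.
    by rewrite [(_^-1)%g]free_group_invE.
  by rewrite (additive_funV eM) exponent_gen mulN1r eq_sym.
by case: b; case: (x == i) => /=; ring.
Qed.

(* Cancels a letter of the word with an occurrence of its inverse, by means of a
   commutator: l u l^-1 v = [l^-1, u^-1] u v. *)
Lemma derived_subgroup_exponent0 (n : nat) (r : free_group 'I_n) :
  (forall i, exponent i r = 0) -> derived_subgroup r.
Proof.
elim/free_groupW: r => w.
elim: {w}(size w) {-2}w (leqnn (size w)) => [|m IHm] w.
  by rewrite leqn0 size_eq0 => /eqP-> _; exact: Subgroup1.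
case: w => [_ _|[x b] w]; first exact: Subgroup1.
rewrite /= ltnS => sw e0.
(* Otherwise all occurrences of [x] would have the same sign and its exponent sum could not
   vanish. *)
have xw : (x, ~~ b) \in w.
  apply/negPn/negP=> /count_memPn cw.
  have := e0 x; rewrite exponent_word /= !xpair_eqE eqxx /=.
  move: cw; case: b {e0} => /= ->; rewrite add0n ?add1n ?addn0.
    by rewrite sub0r => /eqP; rewrite oppr_eq0 Num.Theory.pnatr_eq0.
  by rewrite subr0 => /eqP; rewrite Num.Theory.pnatr_eq0.
case/splitPr: xw sw e0 => u v; rewrite size_cat /= addnS => suv e0.
pose l : free_group 'I_n := word_class [:: (x, b)].
have lV : word_class [:: (x, ~~ b)] = l^-1%g.
  by rewrite [(_^-1)%g]free_group_invE.
have wE : word_class ((x, b) :: u ++ (x, ~~ b) :: v)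
    = ([~ l^-1, (word_class u)^-1] * word_class (u ++ v))%g.
  transitivity (l * word_class u * l^-1 * word_class v)%g.
    rewrite -lV [(l * _)%g]free_group_mulE.
    rewrite [(_ * word_class [:: _])%g]free_group_mulE.
    by rewrite [(_ * _)%g]free_group_mulE /= -catA.
  have -> : word_class (u ++ v) = (word_class u * word_class v)%g.
    by rewrite [(_ * _)%g]free_group_mulE.
  by rewrite /commg /conjg !invgK !mulgA mulgVK.
have dlu : derived_subgroup [~ l^-1, (word_class u)^-1]%g.
  by apply: SubgroupGen; exists l^-1%g, (word_class u)^-1%g.
rewrite wE; apply: SubgroupM; first exact: dlu.
apply: IHm => [|i]; first by rewrite size_cat ltnW.
have eM : {morph @exponent n i : u v / (u * v)%g >-> u + v} by exact: exponentM.
by have := e0 i; rewrite wE eM (additive_fun_derived eM dlu) add0r.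
Qed.

(** Here [k] is the exponent sum of [r] in an expression of [s] as a product of conjugates of [r]
    and their inverses, so it is fixed before [chi]. Additivity of [chi] is asked only when one
    factor lies in the normal closure, so that the quadratic function [magnus_form] qualifies. *)
Lemma normal_closure_multiplier (H : groupType) (r s : H) :
  normal_closure r s -> exists k : rat, forall chi : H -> rat,
    (forall u t, normal_closure r t -> chi (u * t)%g = chi u + chi t) ->
    (forall u t, normal_closure r t -> chi (t * u)%g = chi t + chi u) ->
    chi s = k * chi r.
Proof.
have Nr : normal_closure r r by apply: SubgroupGen; exists 1%g; rewrite conjg1.
elim=> {s} [_ [a ->]||s t Ns [k sE] Nt [l tE]|s Ns [k sE]].
- exists 1 => chi chir chil; rewrite mul1r.
  have Nra : normal_closure r (r ^ a)%g by apply: SubgroupGen; exists a.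
  (* Evaluating [chi] on both sides of [a * r ^ a = r * a] shows that it takes equal values on [r]
     and [r ^ a]. *)
  by apply: (addrI (chi a)); rewrite -chir // -conjgC chil // addrC.
- exists 0 => chi chir _; have := chir 1%g 1%g (Subgroup1 _).
  by rewrite mulg1 mul0r => /eqP; rewrite -subr_eq subrr eq_sym => /eqP.
- by exists (k + l) => chi chir chil; rewrite chir // sE // tE // mulrDl.
- exists (- k) => chi chir chil.
  have NsV : normal_closure r s^-1%g by exact: SubgroupV.
  have chi1 : chi 1%g = 0.
    have := chir 1%g 1%g (Subgroup1 _).
    by rewrite mulg1 => /eqP; rewrite -subr_eq subrr eq_sym => /eqP.
  by apply/eqP; rewrite mulNr -sE // -addr_eq0 -chir // mulVg chi1.
Qed.

(** * Degree 1 homology in the bar complex *)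

Section Homology1.
Variable G : groupType.

Lemma homology_repr_cocycle (f : cohomology1 G) :
  {morph homology_repr f : g h / (g * h)%g >-> g + h}.
Proof. by move=> g h; apply: cocycle1M; exact: homology_reprP. Qed.

Lemma kronecker1_bar_class (f : cohomology1 G) g :
  kronecker1 f (bar_class g) = homology_repr f g.
Proof.
by rewrite -{1}(homology_reprK f) kronecker1E liftU scale1r.
Qed.

(** The bar boundary of [(g, h)] is the difference between the two sides. *)
Lemma bar_classM : {morph @bar_class G : g h / (g * h)%g >-> g + h}.
Proof.
move=> g h; rewrite -[bar_class g]scale1r.
have d0 : bar_d1 G (1 *: << g >> + << h >>) = 0.
  by rewrite linearP /= !liftU !scaler0 addr0.
rewrite -(homology_classP _ _ _ d0 erefl).
apply/homology_class_eqP; exists (- << (g, h) >>).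
rewrite raddfN /= liftU !scale1r !opprD opprK.
by rewrite [- << h >> + _]addrC addrA addrAC.
Qed.

(** Since [bar_d1] is zero, every 1-chain is a cycle, so the classes of group elements span. *)
Lemma bar_class_ind (P : homology1 G -> Prop) : P 0 ->
  (forall a g x, P x -> P (a *: bar_class g + x)) -> forall x, P x.
Proof.
move=> P0 PS; elim/lquotW=> -[x dx].
have -> : Cycle dx = \sum_(g <- dom x)
    coeff g x *: Cycle (introT eqP (bar_class_subproof g)).
  apply: val_inj; rewrite raddf_sum /= -[x in LHS]freeg_sumE.
  apply: eq_bigr => g _.
  by apply/eqP/freeg_eqP=> j; rewrite coeffZ !coeffU mul1r.
rewrite raddf_sum /=; elim: (dom x) => [|g s IHs]; first by rewrite big_nil.
by rewrite big_cons linearZ; exact: PS.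
Qed.

End Homology1.

(** The map [bar_class] is additive, so it kills commutators, and a cycle of class zero is a
    boundary. *)
Lemma derived_boundary (H : groupType) (u : H) : derived_subgroup u ->
  exists w : {freeg (H * H)%type / rat}, bar_d2 H w = << u >>.
Proof.
move=> du; suff : bar_class u = 0.
  have d0 : bar_d1 H 0 = 0 by rewrite raddf0.
  have <- : homology_class (bar_d2 H) d0 = 0.
    rewrite -[RHS](raddf0 (lquot_pi _)); congr (lquot_pi _ _).
    exact: val_inj.
  by move/homology_class_eqP => [w wE]; exists w; rewrite wE subr0.
exact: additive_fun_derived (@bar_classM H) _ du.
Qed.

(** * Cup products of a one-relator group *)

Section Presentation.
Variables (n : nat) (r : free_group 'I_n) (G : groupType).
Variable p : free_group 'I_n -> G.
Hypotheses (pM : {morph p : u v / (u * v)%g})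
  (p_surj : forall g, exists u, p u = g)
  (p_ker : forall u, p u = 1%g <-> normal_closure r u).

Let sect g := projT1 (cid (p_surj g)).
Let sectK g : p (sect g) = g. Proof. exact: projT2 (cid (p_surj g)). Qed.

Lemma presentation_mor1 : p 1%g = 1%g.
Proof. by apply/p_ker; exact: Subgroup1. Qed.

Lemma presentation_morV u : p u^-1%g = (p u)^-1%g.
Proof. by apply: (mulgI (p u)); rewrite -pM !mulgV presentation_mor1. Qed.

Definition lift_class (f : cohomology1 G) u : rat := homology_repr f (p u).

Lemma lift_classM f : {morph lift_class f : u v / (u * v)%g >-> u + v}.
Proof. by move=> u v; rewrite /lift_class pM homology_repr_cocycle. Qed.

Lemma lift_class_relator f u : normal_closure r u -> lift_class f u = 0.
Proof.
move/p_ker; rewrite /lift_class => ->.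
exact: additive_fun1 (@homology_repr_cocycle G f).
Qed.

(** This is the function phi of the overview. *)
Definition magnus_form (f f' : cohomology1 G) u : rat :=
  \sum_(i < n) \sum_(j < n)
    eps2 i j u
      * (lift_class f (free_group_gen i) * lift_class f' (free_group_gen j)).

Lemma magnus_formM f f' u v : magnus_form f f' (u * v)%g
  = magnus_form f f' u + magnus_form f f' v + lift_class f u * lift_class f' v.
Proof.
pose x i := lift_class f (free_group_gen i).
pose y i := lift_class f' (free_group_gen i).
have lE f0 w : lift_class f0 w
    = \sum_(i < n) exponent i w * lift_class f0 (free_group_gen i).
  exact: (@additive_fun_free_group n rat^o _ (@lift_classM f0)).
rewrite (lE f u) (lE f' v) big_distrlr /= -!big_split; apply: eq_bigr => i _.
rewrite -!big_split; apply: eq_bigr => j _ /=.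
by rewrite eps2M; ring.
Qed.

(** The scalar [lam z] is the value of the cochain [k] on a cycle representing [z]. Both assertions
    concern the same [lam], so they are proved together. *)
Lemma cup_pairing : exists lam : homology2 G -> rat,
  (forall f f' z, kronecker2 (cup f f') z = lam z * magnus_form f f' r) /\
  (forall psi : free_group 'I_n -> rat,
     {morph psi : u v / (u * v)%g >-> u + v} ->
     psi r != 0 -> forall z, lam z = 0).
Proof.
(* The failure of the section to be multiplicative, a function with values in the kernel of [p]. *)
pose t (q : G * G) := ((sect (q.1 * q.2)%g)^-1 * (sect q.1 * sect q.2))%g.
have Nt q : normal_closure r (t q).
  by apply/p_ker; rewrite !pM presentation_morV !sectK mulVg.
have tE q : (sect q.1 * sect q.2 = sect (q.1 * q.2) * t q)%g.
  by rewrite /t mulVKg.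
have [k kE] := choice (fun q => normal_closure_multiplier (Nt q)).
exists (fun z => fglift (k : G * G -> rat^o) (homology_repr z)); split.
  move=> f f' z; rewrite -{1}(homology_reprK z) kronecker_cup.
  set x := homology_repr z.
  have phil u s : normal_closure r s ->
      magnus_form f f' (s * u)%g = magnus_form f f' s + magnus_form f f' u.
    by move=> Ns; rewrite magnus_formM lift_class_relator // mul0r addr0.
  have phir u s : normal_closure r s ->
      magnus_form f f' (u * s)%g = magnus_form f f' u + magnus_form f f' s.
    by move=> Ns; rewrite magnus_formM (lift_class_relator f') // mulr0 addr0.
  (* Applying [magnus_form] to [tE] writes the cup cochain as a multiple of [k] minus a coboundary,
     and coboundaries vanish on the cycle [x]. *)
  have -> : cup_cochain (homology_repr f) (homology_repr f')
      = magnus_form f f' r *: (k : G * G -> rat^o)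
        + ((-1) *: cobar_d1 G (magnus_form f f' \o sect) + 0).
    apply/funext=> -[g h]; rewrite addr0.
    change (homology_repr f g * homology_repr f' h = magnus_form f f' r * k (g, h)
      + -1 * (magnus_form f f' (sect h) - magnus_form f f' (sect (g * h)%g)
         + magnus_form f f' (sect g)) :> rat).
    have := congr1 (magnus_form f f') (tE (g, h)) => /=.
    rewrite magnus_formM (phir _ _ (Nt _)) (kE (g, h) _ phir phil).
    rewrite /lift_class !sectK.
    by move/(canRL (addKr _)) => ->; ring.
  rewrite !fglift_linear_fun fglift0 fglift_cobar1 homology_reprP raddf0.
  by rewrite scaler0 !addr0 -/x; exact: mulrC.
move=> psi psiM psir z; set x := homology_repr z.
(* The additive [psi] is also a valid [chi]: applied to [tE], it makes [k] a coboundary. *)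
have -> : (k : G * G -> rat^o) = (psi r)^-1 *: cobar_d1 G (psi \o sect) + 0.
  apply/funext=> -[g h]; rewrite addr0.
  change (k (g, h)
    = (psi r)^-1 * (psi (sect h) - psi (sect (g * h)%g) + psi (sect g))).
  have : psi (sect g) + psi (sect h) = psi (sect (g * h)%g) + psi (t (g, h)).
    by rewrite -!psiM -(tE (g, h)).
  rewrite (kE (g, h) psi) => [|u s _|u s _]; rewrite ?psiM //.
  move=> /(canRL (addKr _)) kpsi; apply: (mulIf psir); rewrite [LHS]/= kpsi.
  by field.
rewrite fglift_linear_fun fglift0 fglift_cobar1 homology_reprP raddf0.
by rewrite scaler0 addr0.
Qed.

Lemma relator_cycle : derived_subgroup r -> exists z : homology2 G,
  forall f f', kronecker2 (cup f f') z = - magnus_form f f' r.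
Proof.
move=> /derived_boundary[w wE].
pose pw : {freeg (G * G)%type / rat} := fglift (fun q => << (p q.1, p q.2) >>) w.
(* The image of [w] has boundary [<< p r >> = << 1 >>], which is also the boundary of
   [<< (1, 1) >>]. The cup cochain vanishes on this degenerate correction, since cocycles vanish at
   1. *)
have dz : bar_d2 G (pw - << (1%g, 1%g) >>) = 0.
  rewrite raddfB /= fglift_comp.
  pose p1 : {linear {freeg (free_group 'I_n) / rat} -> {freeg G / rat}} :=
    fglift (fun u => << p u >>).
  have -> : fglift (fun q : free_group 'I_n * free_group 'I_n =>
      bar_d2 G << (p q.1, p q.2) >>) w = p1 (bar_d2 _ w).
    rewrite fglift_comp; congr (fglift _ w); apply/funext=> -[u v] /=.
    by rewrite raddfD raddfB /= !liftU !scale1r pM.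
  have pr : p r = 1%g.
    by apply/p_ker/SubgroupGen; exists 1%g; rewrite conjg1.
  by rewrite wE /= !liftU !scale1r pr mulg1 subrr add0r subrr.
exists (homology_class _ dz) => f f'; rewrite kronecker_cup raddfB /=.
rewrite liftU scale1r /cup_cochain /=.
rewrite (additive_fun1 (@homology_repr_cocycle G f)) mul0r subr0.
pose c : {linear {freeg (G * G)%type / rat} -> rat^o} :=
  fglift (cup_cochain (homology_repr f) (homology_repr f')).
rewrite -[LHS]/(c pw) /pw fglift_comp.
(* Pulled back to the free group, the cup cochain is minus the coboundary of [magnus_form]; its
   value on [w] is thus read off from the boundary [<< r >>]. *)
have -> : (fun q : free_group 'I_n * free_group 'I_n => c << (p q.1, p q.2) >>)
    = (-1) *: cobar_d1 _ (magnus_form f f' : _ -> rat^o) + 0.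
  apply/funext=> -[u v]; rewrite addr0 /c /= liftU scale1r.
  change (lift_class f u * lift_class f' v = -1 * (magnus_form f f' v
    - magnus_form f f' (u * v)%g + magnus_form f f' u)).
  by rewrite magnus_formM; ring.
rewrite fglift_linear_fun fglift0 fglift_cobar1 wE liftU scale1r addr0.
exact: scaleN1r.
Qed.

End Presentation.

(** * Dual bases of H_1 and H^1, and the resulting coordinates *)

Section DualBases.
Variable G : groupType.

Lemma ext2_pairing_linear_wedge (f1 f2 : cohomology1 G) :
  linear (ext2_pairing (wedge f1 f2)).
Proof.
move=> a u v; rewrite /ext2_pairing !ext2_lift_wedge;
  do ?exact: ext2_pairing_alternating.
exact: ext2_lift_linear (kronecker_det_alternating f1 f2) _ _ _.
Qed.

Lemma wedge_suml (I : finType) (a : I -> rat) (u : I -> homology1 G) v :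
  wedge (\sum_i a i *: u i) v = \sum_i a i *: wedge (u i) v.
Proof.
have [wl _ _] := wedge_alternating (homology1 G).
rewrite -[LHS]/(linear_pack (wl v) _) linear_sum; apply: eq_bigr => i _.
by rewrite linearZ.
Qed.

Lemma wedge_sumr (I : finType) (a : I -> rat) (u : I -> homology1 G) v :
  wedge v (\sum_i a i *: u i) = \sum_i a i *: wedge v (u i).
Proof.
have [_ wr _] := wedge_alternating (homology1 G).
rewrite -[LHS]/(linear_pack (wr v) _) linear_sum; apply: eq_bigr => i _.
by rewrite linearZ.
Qed.

Variable k : nat.
Variables (B : 'I_k -> homology1 G) (f : 'I_k -> cohomology1 G).

(** The first condition makes [B] independent; the second makes it spanning, with coordinates given
    by [f]. *)
Definition dual_bases : Prop :=
  (forall i j, kronecker1 (f i) (B j) = (i == j)%:R) /\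
  (forall x, x = \sum_(i < k) (kronecker1 (f i) x : rat) *: B i).

Hypothesis Bf : dual_bases.

Lemma ext2_dual_bases (om : ext2 (homology1 G)) : 2%:R *: om
  = \sum_(i < k) \sum_(j < k)
      (ext2_pairing (wedge (f i) (f j)) om : rat) *: wedge (B i) (B j).
Proof.
have [_ Bspan] := Bf.
have wE u v : wedge u v = \sum_(i < k) \sum_(j < k)
    (kronecker1 (f i) u * kronecker1 (f j) v : rat) *: wedge (B i) (B j).
  rewrite {1}[u]Bspan wedge_suml; apply: eq_bigr => i _.
  rewrite {1}[v]Bspan wedge_sumr scaler_sumr; apply: eq_bigr => j _.
  by rewrite scalerA.
have pl i j := ext2_pairing_linear_wedge (f i) (f j).
elim/ext2_ind: om => [|a u v om IH].
  rewrite scaler0 big1 // => i _; rewrite big1 // => j _.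
  by rewrite (linear_fun0 (pl i j)) scale0r.
(* Expanding [u /\ v - v /\ u] turns the coefficients into determinants. The factor 2 comes from
   summing over ordered pairs. *)
have w2 : 2%:R *: wedge u v = \sum_(i < k) \sum_(j < k)
    (kronecker_det (f i) (f j) u v : rat) *: wedge (B i) (B j).
  rewrite scaler_nat mulr2n {2}(alternatingC u v (wedge_alternating _)).
  rewrite (wE u v) (wE v u) -sumrB; apply: eq_bigr => i _.
  rewrite -sumrB; apply: eq_bigr => j _.
  by rewrite -scalerBl.
rewrite scalerDr scalerA mulrC -scalerA w2 IH scaler_sumr -big_split.
apply: eq_bigr => i _; rewrite scaler_sumr -big_split; apply: eq_bigr => j _ /=.
by rewrite pl ext2_pairing_wedge scalerA -scalerDl.
Qed.

(** Nondegeneracy of the pairing, obtained by dividing [ext2_dual_bases] by 2; it allows [cup_dual]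
    to be computed from its pairings. *)
Lemma ext2_pairing_inj (om om' : ext2 (homology1 G)) :
  (forall i j, ext2_pairing (wedge (f i) (f j)) om
     = ext2_pairing (wedge (f i) (f j)) om') -> om = om'.
Proof.
move=> omE; have inv2 (x : ext2 (homology1 G)) : x = 2%:R^-1 *: (2%:R *: x).
  by rewrite scalerA mulVf ?scale1r.
rewrite [om]inv2 [om']inv2 !ext2_dual_bases; congr (_ *: _).
by apply: eq_bigr => i _; apply: eq_bigr => j _; rewrite omE.
Qed.

Definition lie_coord (v : homology1 G) : free_lie rat 'I_k :=
  \sum_(i < k) (kronecker1 (f i) v : rat) *: free_lie_gen rat i.

Definition lie_to_free : free_lie_on (homology1 G) -> free_lie rat 'I_k :=
  lie_pres_lift lie_coord (rel := @free_lie_on_rel _ _).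

Definition lie_of_free : free_lie rat 'I_k -> free_lie_on (homology1 G) :=
  lie_pres_lift (fun i => free_lie_on_gen (B i)) (rel := @free_lie_rel _ _).

Lemma lie_coord_rel x y : free_lie_on_rel x y ->
  lie_eval lie_coord x = lie_eval lie_coord y.
Proof.
case=> a u v /=; rewrite /lie_coord scaler_sumr -big_split; apply: eq_bigr => i _ /=.
by rewrite kronecker1_linearr scalerA -scalerDl.
Qed.

Lemma lie_to_free_morphism : lie_morphism lie_to_free.
Proof. exact: lie_pres_lift_morphism lie_coord_rel. Qed.

Lemma lie_of_free_morphism : lie_morphism lie_of_free.
Proof. by apply: lie_pres_lift_morphism. Qed.

Lemma lie_of_free_gen i : lie_of_free (free_lie_gen rat i) = free_lie_on_gen (B i).
Proof. by rewrite /lie_of_free lie_pres_lift_gen. Qed.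

(** On generators this is the expansion of [v] in the basis [B]; the opposite composite uses duality
    instead. *)
Lemma lie_to_freeK : cancel lie_to_free lie_of_free.
Proof.
have [_ Bspan] := Bf.
apply: (@lie_morphism_ext _ _ _ _ (lie_of_free \o lie_to_free) id) => [||v] //.
  exact: lie_morphism_comp lie_to_free_morphism lie_of_free_morphism.
rewrite /= /lie_to_free (lie_pres_lift_gen lie_coord_rel).
rewrite (lie_morphism_sum _ _ lie_of_free_morphism).
rewrite -/(free_lie_on_gen v) [v in RHS]Bspan raddf_sum; apply: eq_bigr => i _ /=.
by rewrite (lie_morphismZ _ _ lie_of_free_morphism) lie_of_free_gen linearZ.
Qed.

Lemma lie_of_freeK : cancel lie_of_free lie_to_free.
Proof.
have [Bdual _] := Bf.
apply: (@lie_morphism_ext _ _ _ _ (lie_to_free \o lie_of_free) id) => [||i] //.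
  exact: lie_morphism_comp lie_of_free_morphism lie_to_free_morphism.
rewrite /= [lie_of_free _]lie_of_free_gen.
rewrite /lie_to_free (lie_pres_lift_gen lie_coord_rel).
rewrite /lie_coord (bigD1 i) //= Bdual eqxx scale1r big1 ?addr0 // => j /negPf ji.
by rewrite Bdual ji scale0r.
Qed.

Lemma lie_to_free_degree d x : free_lie_on_degree d x ->
  free_lie_degree d (lie_to_free x).
Proof.
apply: (lie_pres_lift_degree lie_coord_rel) => [v|e|e a y z|e e' y z].
- rewrite /lie_coord; elim/big_rec: _ => [|i y _ dy]; first exact: LieDeg0.
  by apply: LieDegLin => //; exact: LieDegGen.
- exact: LieDeg0.
- exact: LieDegLin.
- exact: LieDegBracket.
Qed.

Lemma lie_of_free_degree d x : free_lie_degree d x ->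
  free_lie_on_degree d (lie_of_free x).
Proof.
apply: lie_pres_lift_degree => [//|i|e|e a y z|e e' y z].
- exact: LieDegGen.
- exact: LieDeg0.
- exact: LieDegLin.
- exact: LieDegBracket.
Qed.

End DualBases.

(** * Holonomy Lie algebras in the two cases *)

Section OneRelatorHolonomy.
Variables (n : nat) (r : free_group 'I_n) (G : groupType).
Variable p : free_group 'I_n -> G.
Hypotheses (pM : {morph p : u v / (u * v)%g})
  (p_surj : forall g, exists u, p u = g)
  (p_ker : forall u, p u = 1%g <-> normal_closure r u).

Let X i : homology1 G := bar_class (p (free_group_gen i)).

(** Additive functions [c i] killing [r] descend to classes in H^1. The map [t] selects the
    generators forming a basis, and the last hypothesis expresses the others through them. *)
Lemma dual_bases_presentation (k : nat) (c : 'I_k -> free_group 'I_n -> rat)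
    (t : 'I_k -> 'I_n) :
  (forall i, {morph c i : u v / (u * v)%g >-> u + v}) ->
  (forall i, c i r = 0) ->
  (forall i j, c i (free_group_gen (t j)) = (i == j)%:R) ->
  (forall l, X l = \sum_(i < k) c i (free_group_gen l) *: X (t i)) ->
  exists f, dual_bases (X \o t) f.
Proof.
move=> cM cr ct cX.
have [sect sectK] := choice p_surj.
(* As [c i] kills the normal closure of [r], it is constant on the fibres of [p]. *)
have cp i u : c i (sect (p u)) = c i u.
  have : c i (u^-1 * sect (p u))%g = 0.
    apply: (additive_fun_normal_closure (cM i) (cr i)).
    by apply/p_ker; rewrite pM (presentation_morV pM p_ker) sectK mulVg.
  by rewrite cM (additive_funV (cM i)) addrC => /eqP; rewrite subr_eq0 => /eqP.
have df i : cobar_d1 G (c i \o sect) = 0.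
  apply/funext=> -[g h] /=.
  have -> : (g * h)%g = p (sect g * sect h)%g by rewrite pM !sectK.
  rewrite cp cM.
  change (c i (sect h) - (c i (sect g) + c i (sect h)) + c i (sect g) = 0).
  by ring.
pose f i : cohomology1 G := homology_class (cobar_d0 G) (df i).
have fE i u : kronecker1 (f i) (bar_class (p u)) = c i u.
  by rewrite /f kronecker1E liftU scale1r /= cp.
exists f; split=> [i j|x]; first by rewrite /= fE ct.
elim/bar_class_ind: x => [|a g x IHx].
  rewrite big1 // => i _; rewrite (linear_fun0 (kronecker1_linearr _)).
  exact: scale0r.
have [u <-] := p_surj g.
have bE : bar_class (p u) = \sum_(i < k) c i u *: X (t i).
  have bM : {morph (fun u => bar_class (p u)) : u v / (u * v)%g >-> u + v}.
    by move=> v w; rewrite pM bar_classM.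
  rewrite (additive_fun_free_group bM).
  transitivity (\sum_(l < n) \sum_(i < k)
      (exponent l u * c i (free_group_gen l)) *: X (t i)).
    apply: eq_bigr => l _; rewrite -/(X l) cX scaler_sumr.
    by apply: eq_bigr => i _; rewrite scalerA.
  rewrite exchange_big; apply: eq_bigr => i _; rewrite -scaler_suml.
  by rewrite (@additive_fun_free_group n rat^o _ (cM i)).
rewrite {1}IHx {1}bE scaler_sumr -big_split; apply: eq_bigr => i _ /=.
by rewrite kronecker1_linearr fE scalerA -scalerDl.
Qed.

Section Commutator.
Hypothesis dr : derived_subgroup r.

Lemma dual_bases_commutator : exists f, dual_bases X f.
Proof.
apply: (@dual_bases_presentation n (@exponent n) id) => [i|i|i j|l].
- exact: exponentM.
- exact: additive_fun_derived (@exponentM n i) _ dr.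
- exact: exponent_gen.
- rewrite (bigD1 l) //= exponent_gen eqxx scale1r big1 ?addr0 // => i /negPf il.
  by rewrite exponent_gen il scale0r.
Qed.

Definition relator_ext2 : ext2 (homology1 G) :=
  \sum_(i < n) \sum_(j < n | (i < j)%N) eps2 i j r *: wedge (X i) (X j).

(** Antisymmetry of [eps2] removes the diagonal of the double sum and folds the terms with [j < i]
    onto those with [i < j], producing the determinants of the pairing. *)
Lemma ext2_pairing_relator (f f' : cohomology1 G) :
  ext2_pairing (wedge f f') relator_ext2 = magnus_form p f f' r.
Proof.
pose T i j : rat :=
  lift_class p f (free_group_gen i) * lift_class p f' (free_group_gen j).
have e_anti i j : eps2 i j r = - eps2 j i r by exact: eps2_antisym.
have e0 i : eps2 i i r = 0.
  have /eqP := e_anti i i.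
  by rewrite -addr_eq0 -mulr2n Num.Theory.mulrn_eq0 /= => /eqP.
rewrite -[LHS]/(linear_pack (ext2_pairing_linear_wedge f f') _) /relator_ext2.
rewrite linear_sum /magnus_form.
transitivity (\sum_(i < n) \sum_(j < n | (i < j)%N)
    eps2 i j r * (T i j - T j i)).
  apply: eq_bigr => i _; rewrite linear_sum; apply: eq_bigr => j _.
  by rewrite linearZ /= ext2_pairing_wedge /kronecker_det !kronecker1_bar_class.
have -> : \sum_(i < n) \sum_(j < n) eps2 i j r * T i j
    = \sum_(i < n) \sum_(j < n | (i < j)%N) eps2 i j r * T i j
      + \sum_(i < n) \sum_(j < n | (j < i)%N) eps2 i j r * T i j.
  rewrite -big_split; apply: eq_bigr => i _ /=.
  rewrite (bigID (fun j : 'I_n => (i < j)%N)) /=; congr (_ + _).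
  rewrite (bigD1 i) ?ltnn //= e0 mul0r add0r; apply: eq_bigl => j.
  by rewrite -leqNgt andbC -ltn_neqAle.
rewrite [X in _ + X](exchange_big_dep predT) //= -big_split.
apply: eq_bigr => i _; rewrite -big_split; apply: eq_bigr => j _ /=.
by rewrite (e_anti j i); ring.
Qed.

Lemma holonomy_commutator :
  graded_lie_isomorphic (@holonomy_degree G)
    (lie_quot_degree (S := fun y => y = magnus_lie2 r)
      (@free_lie_degree rat 'I_n)).
Proof.
have [f Xf] := dual_bases_commutator.
have [lam [cupE _]] := cup_pairing pM p_surj p_ker.
have [z0 z0E] := relator_cycle pM p_ker dr.
have el := ext2_to_lie_linear (V := homology1 G).
pose e := linear_pack el.
have relE : lie_of_free X (magnus_lie2 r) = e relator_ext2.
  have gm := lie_of_free_morphism X.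
  rewrite /magnus_lie2 (lie_morphism_sum _ _ gm) linear_sum.
  apply: eq_bigr => i _; rewrite (lie_morphism_sum _ _ gm) linear_sum.
  apply: eq_bigr => j _; rewrite (lie_morphismZ _ _ gm) linearZ (proj2 gm).
  by rewrite !lie_of_free_gen /= ext2_to_lie_wedge.
have dualE z : cup_dual z = lam z *: relator_ext2.
  apply: (ext2_pairing_inj Xf) => i j; rewrite cup_dualP cup_map_wedge cupE.
  have pl := ext2_pairing_linear_wedge (f i) (f j).
  rewrite -[RHS]/(linear_pack pl _) linearZ.
  by rewrite /= ext2_pairing_relator.
(* With [dualE], this shows that the image of the dual cup product is exactly the line of
   [relator_ext2], so the two ideals correspond. *)
have dual0 : cup_dual z0 = - relator_ext2.
  apply: (ext2_pairing_inj Xf) => i j; rewrite cup_dualP cup_map_wedge z0E.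
  have pl := ext2_pairing_linear_wedge (f i) (f j).
  rewrite -[RHS]/(linear_pack pl _) raddfN.
  by rewrite /= ext2_pairing_relator.
apply: (graded_lie_isomorphic_quot (lie_to_free_morphism f)
  (lie_of_free_morphism X) (lie_to_freeK Xf) (lie_of_freeK Xf)).
- exact: lie_to_free_degree.
- exact: lie_of_free_degree.
- move=> _ [z ->]; rewrite dualE -[ext2_to_lie _]/(e _) linearZ -relE.
  rewrite (lie_morphismZ _ _ (lie_to_free_morphism f)) (lie_of_freeK Xf).
  by rewrite rpredZ // lie_ideal_gen.
- move=> _ ->; rewrite relE -[relator_ext2]opprK -dual0 raddfN -scaleN1r.
  rewrite rpredZ //.
  by apply: lie_ideal_gen; exists z0.
Qed.

End Commutator.

Lemma dual_bases_noncommutator m : exponent m r != 0 ->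
  exists f, dual_bases (X \o fintype.lift m) f.
Proof.
move=> er0.
(* The correction by a multiple of [exponent m] makes [c i] vanish on [r] and leaves its values on
   the generators other than [m] unchanged. *)
pose c (i : 'I_n.-1) u :=
  exponent (fintype.lift m i) u
    - exponent (fintype.lift m i) r / exponent m r * exponent m u.
apply: (@dual_bases_presentation _ c) => [i u v|i|i j|l].
- by rewrite /c !exponentM; ring.
- by rewrite /c divfK ?subrr.
- rewrite /c !exponent_gen (inj_eq lift_inj) (negPf (neq_lift _ _)).
  by rewrite mulr0 subr0.
have [i ->|->] := unliftP m l.
  rewrite (bigD1 i) //= big1 => [|j /negPf ji]; rewrite /c !exponent_gen.
    by rewrite eqxx (negPf (neq_lift _ _)) mulr0 subr0 scale1r addr0.
  rewrite (inj_eq lift_inj) ji (negPf (neq_lift _ _)).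
  by rewrite mulr0 subr0 scale0r.
have bM : {morph (fun u => bar_class (p u)) : u v / (u * v)%g >-> u + v}.
  by move=> v w; rewrite pM bar_classM.
have : bar_class (p r) = 0.
  have -> : p r = 1%g by apply/p_ker/SubgroupGen; exists 1%g; rewrite conjg1.
  exact: additive_fun1 (@bar_classM G).
(* The relation [bar_class (p r) = 0] is solved for [X m], whose coefficient is nonzero. *)
rewrite (additive_fun_free_group bM) (bigD1_ord m) //= -/(X m).
move/(canRL (addrK _)); rewrite sub0r.
move/(congr1 (fun x => (exponent m r)^-1 *: x)).
rewrite scalerA mulVf // scale1r => ->; rewrite -sumrN scaler_sumr.
apply: eq_bigr => i _; rewrite /c !exponent_gen eqxx eq_sym (negPf (neq_lift _ _)).
by rewrite mulr1 sub0r scalerN scaleNr scalerA mulrC.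
Qed.

Lemma holonomy_noncommutator : ~ derived_subgroup r ->
  graded_lie_isomorphic (@holonomy_degree G) (@free_lie_degree rat 'I_n.-1).
Proof.
move=> ndr.
(* The index [m] also forces [n] to be positive, so [n.-1] is not truncated. *)
have [m er0] : exists m, exponent m r != 0.
  apply: contrapT => e0; apply/ndr/derived_subgroup_exponent0 => i.
  by apply/eqP/negPn/negP => ei; apply: e0; exists i.
have [f Xf] := dual_bases_noncommutator er0.
have [lam [cupE lam0]] := cup_pairing pM p_surj p_ker.
have dual0 (z : homology2 G) : cup_dual z = 0.
  apply: (ext2_pairing_inj Xf) => i j; rewrite cup_dualP cup_map_wedge cupE.
  rewrite (lam0 _ (@exponentM n m) er0) mul0r.
  by rewrite (linear_fun0 (ext2_pairing_linear_wedge _ _)).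
have rel0 (y : free_lie_on (homology1 G)) : holonomy_relation y -> y = 0.
  by case=> z ->; rewrite dual0 (linear_fun0 (ext2_to_lie_linear (V := _))).
have fm := lie_to_free_morphism f.
have frel y : holonomy_relation y -> lie_to_free f y = 0.
  by move/rel0->; exact: lie_morphism0.
pose F : holonomy_lie G -> free_lie rat 'I_n.-1 := lquot_lift (lie_to_free f).
pose F' y : holonomy_lie G := lie_quot_pi _ (lie_of_free (X \o fintype.lift m) y).
apply: (@graded_lie_isomorphicI _ _ _ _ _ F F').
- exact: lie_quot_lift_morphism fm frel.
- by elim/lie_quotW=> x; rewrite /F (lie_quot_liftE fm frel) /F' lie_to_freeK.
- by move=> x; rewrite /F (lie_quot_liftE fm frel) (lie_of_freeK Xf).
- exact: (lie_quot_lift_degree fm frel (@lie_to_free_degree _ _ f)).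
- move=> k y dy; exists (lie_of_free (X \o fintype.lift m) y) => //.
  exact: lie_of_free_degree.
Qed.

End OneRelatorHolonomy.

Theorem proposition8p1 (n : nat) (r : free_group 'I_n) (G : groupType)
    (hG : one_relator_presentation r G) :
  (derived_subgroup r ->
     graded_lie_isomorphic (@holonomy_degree G)
       (lie_quot_degree (S := fun y => y = magnus_lie2 r)
          (@free_lie_degree rat 'I_n)))
  /\
  (~ derived_subgroup r ->
     graded_lie_isomorphic (@holonomy_degree G)
       (@free_lie_degree rat 'I_n.-1)).
Proof.
have [p [pM p_surj p_ker]] := hG; split.
- exact: holonomy_commutator pM p_surj p_ker.
- exact: holonomy_noncommutator pM p_surj p_ker.
Qed.
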